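(* Let $\sigma>0$, let $M>0$ be a constant, let $s\ge1$ and $p$ be integers with $2s\le p$, and let $\Sigma\in\mathbb{R}^{p\times p}$ be a covariance matrix satisfying, for some $\kappa,\kappa_u>0$ with $\kappa_u\asymp\kappa$, $$\inf_{|\mathrm{supp}(v)|=2s}\frac{\|\Sigma^{1/2}v\|}{\|v\|}\ge\kappa,\qquad \sup_{|\mathrm{supp}(v)|=2s}\frac{\|\Sigma^{1/2}v\|}{\|v\|}\le\kappa_u .$$ Let $\Theta(s,M,\sigma,\kappa)=\{\theta\in\mathbb{R}^p:|\mathrm{supp}(\theta)|\le s,\ \|\theta\|\le M\sigma/\kappa\}$, and for $\theta\in\Theta(s,M,\sigma,\kappa)$ let $P_\theta$ be the law of $(X,y)\in\mathbb{R}^p\times\mathbb{R}$ with $X\sim N(0,\Sigma)$ and $y\mid X\sim N(X^T\theta,\sigma^2)$. For $\epsilon\in[0,1]$, let $(X_1,y_1),\dots,(X_n,y_n)$ be i.i.d. from $(1-\epsilon)P_\theta+\epsilon Q$, and let $\hat\theta$ be the pairwise-tournament estimator (defined in the context) over $\Theta(s,M,\sigma,\kappa)$ with $\delta\asymp\sqrt{\frac{s\log(ep/s)}{n}}$. Assume $s\log\frac{ep}{s}\le cn$ with some sufficiently small constant $c>0$. Then there are constants $C,C'>0$ such that $$\|\Sigma^{1/2}(\hat\theta-\theta)\|^2\le C\sigma^2\left(\frac{s\log\frac{ep}{s}}{n}\vee\epsilon^2\right),\qquad \|\hat\theta-\theta\|^2\le C\frac{\sigma^2}{\kappa^2}\left(\frac{s\log\frac{ep}{s}}{n}\vee\epsilon^2\right),$$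 with $\mathbb{P}_{(\epsilon,\theta,Q)}$-probability at least $1-\exp\left(-C'\left(s\log\frac{ep}{s}+n\epsilon^2\right)\right)$, uniformly over $\theta\in\Theta(s,M,\sigma,\kappa)$ and all probability distributions $Q$.
   Context: $\|\cdot\|$ is the Euclidean norm; $\mathrm{supp}(v)=\{j:v_j\ne0\}$; $a\vee b=\max(a,b)$; $e$ is Euler's number; $\mathsf{TV}$ is total variation distance. $\mathbb{P}_{(\epsilon,\theta,Q)}$ is the law under which the data are i.i.d. from $(1-\epsilon)P_\theta+\epsilon Q$. The relation $a\asymp b$ means $c_1b\le a\le c_2b$ for fixed constants $0<c_1\le c_2$. The constants $c,C,C'$ do not depend on $n,p,s,\sigma,\kappa,\Sigma,\epsilon,\theta,Q$ (they may depend on $M$ and the constants implicit in the relations $\asymp$). Tournament estimator over a parameter set $\Theta$ at scale $\delta$: let $\{\theta_1,\dots,\theta_m\}\subset\Theta$ be a $\delta$-covering set of minimal cardinality, i.e. $m$ is the smallest number such that for every $\theta\in\Theta$ there is $j$ with $\mathsf{TV}(P_{\theta_j},P_\theta)\le\delta$. Writing $Z_i=(X_i,y_i)$ and $p_\theta$ for the density of $P_\theta$ with respect to a common dominating measure, for $j\ne k$ put $A_{jk}=\{p_{\theta_j}>p_{\theta_k}\}$, $P_n(A)=\frac1n\sum_{i=1}^n\mathbb{I}\{Z_i\in A\}$ and $\phi_{jk}=\mathbb{I}\{|P_n(A_{jk})-P_{\theta_j}(A_{jk})|>|P_n(A_{jk})-P_{\theta_k}(A_{jk})|\}$. Then $\hat\theta=\theta_{\hat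 j}$ with $\hat j\in\arg\min_j\sum_{k\ne j}\phi_{jk}$ (any minimizer). *)

(* Defs.v *)
From HB Require Import structures.
From mathcomp Require Import all_boot all_order all_algebra.
From mathcomp Require Import all_classical all_reals all_analysis.

Set Implicit Arguments.
Unset Strict Implicit.
Unset Printing Implicit Defensive.

Import Order.TTheory GRing.Theory Num.Theory.
Import numFieldNormedType.Exports.

Local Open Scope classical_set_scope.
Local Open Scope ring_scope.

Section linear_algebra.
Context {R : realType} {p : nat}.
Implicit Types (v theta : 'cV[R]_p) (S Sigma : 'M[R]_p).

(* The library norm on matrices is the sup norm. *)
Definition enorm v : R := Num.sqrt (\sum_i v i 0 ^+ 2).

Definition supp v : {set 'I_p} := [set j | v j 0 != 0].

Definition quad_form S v : R := (v^T *m S *m v) 0 0.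

Definition psd S : Prop := S^T = S /\ forall v, 0 <= quad_form S v.

(* [S] is the (unique) square root [Sigma^{1/2}] of [Sigma]. *)
Definition is_psd_sqrt Sigma S : Prop := psd S /\ S *m S = Sigma.

Definition stretch_ratios S (k : nat) : set (\bar R) :=
  [set (enorm (S *m v) / enorm v)%:E | v in [set v | #|supp v| = k]].

Definition param_set (s : nat) (M sigma kappa : R) : set 'cV[R]_p :=
  [set theta | (#|supp theta| <= s)%N /\ enorm theta <= M * sigma / kappa].

(* Points of R^p that carry a sigma-algebra are tuples, those on which matrices
   act are column vectors. *)
Definition inner (x : p.-tuple R) theta : R := \sum_i tnth x i * theta i 0.

End linear_algebra.

Section regression_model.
Context {R : realType} {p : nat}.

(* N(m, sd^2), including the degenerate case; [normal_prob m 0] in the library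
   is not a Dirac mass. *)
Definition normal_law (m sd : R) (B : set R) : \bar R :=
  if sd == 0 then \d_m B else normal_prob m sd B.

(* mu = N(0, Sigma), with Sigma possibly singular: every linear functional u is
   normal with mean 0 and variance u^T Sigma u. *)
Definition centered_gaussian (Sigma : 'M[R]_p)
    (mu : probability (p.-tuple R) R) : Prop :=
  forall (u : 'cV[R]_p) (B : set R), measurable B ->
    mu [set x | B (inner x u)] = normal_law 0 (Num.sqrt (quad_form Sigma u)) B.

(* Law of (X, y) when X ~ mu and y | X ~ N(X^T theta, sigma^2). *)
Definition regression_law (mu : probability (p.-tuple R) R) (sigma : R)
    (theta : 'cV[R]_p) (E : set (p.-tuple R * R)) : \bar R :=
  (\int[mu]_x normal_prob (inner x theta) sigma (xsection E x))%E.

End regression_model.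

Section sampling.
Context {R : realType} {d : measure_display} {T : measurableType d}.

Definition mixture (eps : R) (P Q : set T -> \bar R) (A : set T) : \bar R :=
  ((1 - eps)%:E * P A + eps%:E * Q A)%E.

Definition tv_dist (P Q : set T -> \bar R) : \bar R :=
  ereal_sup [set `|P A - Q A|%E | A in measurable].

Definition is_density (nu : {measure set T -> \bar R}) (f : T -> R)
    (P : set T -> \bar R) : Prop :=
  [/\ measurable_fun setT f, (forall z, 0 <= f z) &
      forall A, measurable A -> P A = (\int[nu]_(z in A) (f z)%:E)%E].

(* Taking [A i = setT] for some of the i gives the marginals and the product
   rule for every subfamily. *)
Definition iid_sample (n : nat) {d' : measure_display}
    {Omega : measurableType d'} (Pr : probability Omega R)
    (Z : 'I_n -> Omega -> T) (P : set T -> \bar R) : Prop :=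
  (forall i, measurable_fun setT (Z i)) /\
  forall A : 'I_n -> set T, (forall i, measurable (A i)) ->
    Pr [set w | forall i, A i (Z i w)] = (\prod_(i < n) P (A i))%E.

(* Inner probability; it agrees with [q%:E <= Pr A] when A is measurable, and
   lets an estimator break ties in a non-measurable way. *)
Definition holds_with_prob (Pr : probability T R) (A : set T) (q : R) : Prop :=
  exists E : set T, [/\ measurable E, E `<=` A & (q%:E <= Pr E)%E].

End sampling.

Section tournament.
Context {R : realType} {d : measure_display} {T : measurableType d}.
Context {U : Type} (P : U -> set T -> \bar R) (dens : U -> T -> R).

Definition tv_cover (Theta : set U) (delta : R) (m : nat) (th : 'I_m -> U) :=
  (forall j, Theta (th j)) /\
  forall t, Theta t -> exists j, (tv_dist (P (th j)) (P t) <= delta%:E)%E.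

Definition minimal_tv_cover (Theta : set U) (delta : R) (m : nat)
    (th : 'I_m -> U) :=
  tv_cover Theta delta th /\
  forall (m' : nat) (th' : 'I_m' -> U), tv_cover Theta delta th' -> (m <= m')%N.

Definition empirical (n : nat) (z : 'I_n -> T) (A : set T) : R :=
  (\sum_(i < n) \1_A (z i)) / n%:R.

Definition scheffe_set (t u : U) : set T := [set z | dens u z < dens t z].

(* [phi z t u] is true when u beats t. *)
Definition phi (n : nat) (z : 'I_n -> T) (t u : U) : bool :=
  let A := scheffe_set t u in
  `|empirical z A - fine (P u A)| < `|empirical z A - fine (P t A)|.

Definition losses (n : nat) (z : 'I_n -> T) (m : nat) (th : 'I_m -> U)
    (j : 'I_m) : nat :=
  (\sum_(k < m | k != j) phi z (th j) (th k))%N.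

Definition tournament_estimator (n m : nat) (th : 'I_m -> U)
    (est : ('I_n -> T) -> U) : Prop :=
  forall z, exists j,
    est z = th j /\ forall k, (losses z th j <= losses z th k)%N.

End tournament.

(* s log(e p / s) *)
Definition sparse_entropy (R : realType) (s p : nat) : R :=
  s%:R * ln (expR 1 * p%:R / s%:R).

(* Main.v *)
Require Import Defs.
From HB Require Import structures.
From mathcomp Require Import all_boot all_order all_algebra.
From mathcomp Require Import all_classical all_reals all_analysis.
From mathcomp Require Import measurable_realfun.
From mathcomp Require Import ring lra.

(** Total variation between two regression laws is comparable to
    ‖Σ^{1/2}(θ - θ')‖ / σ as long as this ratio is bounded, and over the
    parameter set it is bounded because the norm constraint and the sparse
    eigenvalues involve the same κ. The upper comparison
    [regression_tv_le] integrates the distance of two normal laws over the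
    design; the lower one [regression_tv_ge] exhibits one event that separates
    the two laws. It therefore suffices to bound the total variation between
    the winner and the true law by a multiple of r, where r² is the larger of
    s log(ep/s) / n and ε²; multiplying by σ gives the prediction error and
    dividing by κ the estimation error.

    In total variation the argument is that of Scheffé tournaments. On the set
    where the density of one candidate exceeds that of the other, their
    probabilities differ by their total variation distance
    ([tv_density]). Hence a candidate within O(r) of the true law beats a
    candidate at distance t from it, t being large compared with r, unless an
    empirical frequency deviates by t / 8, an event of probability at most
    2 exp(- n t² / 512) ([empirical_tail]). When no such deviation occurs, a
    candidate that is too far loses to every near candidate, while the best
    candidate loses at most to the other near ones, so the far candidate has
    more losses ([tournament_winner]).

    What remains is a union bound over pairs of a near and a far candidate.
    The total number of candidates is not controlled by exp(n r²): the
    entropy of the whole parameter set at scale δ contains s log(1 / δ). The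
    minimality of the cover gives a local bound instead: the candidates within
    ρ of the true law are at most as many as it takes to cover the ball of
    radius ρ + δ, since otherwise these could be exchanged
    ([local_cover_card]). A volume-free count of quantized sparse vectors shows
    that this number is at most exp(O(s log(ep/s) + s ρ / δ))
    ([card_cheap_codes], [regression_local_count]). It grows exponentially in
    ρ, which the Gaussian factor exp(- n ρ² / 512) outweighs: the sum over
    shells around the true law is at most exp(- n r²) ([peeling]). *)

Set Implicit Arguments.
Unset Strict Implicit.
Unset Printing Implicit Defensive.

Import Order.TTheory GRing.Theory Num.Theory.
Import numFieldNormedType.Exports.

Local Open Scope classical_set_scope.
Local Open Scope ring_scope.

(** * Additive laws and total variation *)

Section finitely_additive.
Context {R : realType} {d : measure_display} {T : measurableType d}.
Implicit Types (P Q S : set T -> \bar R) (A B : set T).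

(** Finite additivity on measurable sets suffices for all that concerns total
    variation, and it passes to regression laws and to mixtures, which are bare
    set functions. *)
Definition additive_law P : Prop :=
  [/\ P setT = 1%E, (forall A, measurable A -> (0 <= P A)%E) &
      forall A B, measurable A -> measurable B ->
        P A = (P (A `&` B) + P (A `\` B))%E].

Lemma additive_law_probability (P : probability T R) : additive_law P.
Proof.
split; [exact: probability_setT|by move=> A _; exact: measure_ge0|].
move=> A B mA mB; rewrite -measureU ?setUIDK//; first exact: measurableI.
- exact: measurableD.
- by apply/seteqP; split => x // [[_ ?] []].
Qed.

Lemma additive_law_le1 P A : additive_law P -> measurable A -> (P A <= 1)%E.
Proof.
move=> [PT P0 PD] mA; rewrite -PT (PD setT A)// setTI leeDl//.
by apply: P0; exact: measurableD.
Qed.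

Lemma additive_law_fin P A : additive_law P -> measurable A -> P A \is a fin_num.
Proof.
move=> Pl mA; have [_ P0 _] := Pl; rewrite ge0_fin_numE ?P0//.
by rewrite (le_lt_trans (additive_law_le1 Pl mA))// ltry.
Qed.

Lemma additive_law_fine P A : additive_law P -> measurable A ->
  (fine (P A))%:E = P A.
Proof. by move=> Pl mA; rewrite fineK// additive_law_fin. Qed.

Lemma additive_law_leD P Q A (x : R) : additive_law P -> additive_law Q ->
  measurable A -> (P A <= Q A + x%:E)%E <-> fine (P A) <= fine (Q A) + x.
Proof.
move=> Pl Ql mA; rewrite -lee_fin EFinD.
by rewrite (additive_law_fine Pl mA) (additive_law_fine Ql mA).
Qed.

Lemma additive_law_split P A B : additive_law P -> measurable A ->
  measurable B -> fine (P A) = fine (P (A `&` B)) + fine (P (A `\` B)).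
Proof.
move=> Pl mA mB; have [_ _ PD] := Pl.
rewrite {1}(PD _ _ mA mB) fineD//; apply: additive_law_fin => //.
- exact: measurableI.
- exact: measurableD.
Qed.

Lemma additive_law_01 P A : additive_law P -> measurable A ->
  0 <= fine (P A) <= 1.
Proof.
move=> Pl mA; have [_ P0 _] := Pl; apply/andP; split; first exact/fine_ge0/P0.
by rewrite -lee_fin additive_law_fine// additive_law_le1.
Qed.

Lemma additive_lawC P A : additive_law P -> measurable A ->
  fine (P (~` A)) = 1 - fine (P A).
Proof.
move=> Pl mA; have [PT _ _] := Pl.
have := additive_law_split Pl measurableT mA.
rewrite PT setTI setTD /= => ->; lra.
Qed.

Lemma additive_law_mixture P Q (eps : R) : 0 <= eps <= 1 ->
  additive_law P -> additive_law Q -> additive_law (mixture eps P Q).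
Proof.
move=> /andP[e0 e1] Pl Ql; have [PT P0 PD] := Pl; have [QT Q0 QD] := Ql.
have e1' : 0 <= 1 - eps by rewrite subr_ge0.
split.
- by rewrite /mixture PT QT !mule1 -EFinD subrK.
- by move=> A mA; rewrite /mixture adde_ge0// mule_ge0 ?lee_fin ?P0 ?Q0.
- move=> A B mA mB; rewrite /mixture (PD _ _ mA mB) (QD _ _ mA mB).
  have mI := measurableI _ _ mA mB; have mD := measurableD mA mB.
  rewrite -(additive_law_fine Pl mI) -(additive_law_fine Pl mD).
  rewrite -(additive_law_fine Ql mI) -(additive_law_fine Ql mD).
  by rewrite -!EFinD; congr EFin; ring.
Qed.

(** Passing from B to A adds the part of A that B misses, on which P exceeds Q,
    and removes the part of B outside A, on which Q exceeds P. The other sign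
    is the same argument for the complement of B. *)
Lemma scheffe_dist P Q A B : additive_law P -> additive_law Q ->
  measurable A -> measurable B ->
  (forall C, measurable C -> C `<=` A -> (Q C <= P C)%E) ->
  (forall C, measurable C -> C `<=` ~` A -> (P C <= Q C)%E) ->
  `|fine (P B) - fine (Q B)| <= fine (P A) - fine (Q A).
Proof.
move=> Pl Ql mA mB QP PQ.
have QP' C : measurable C -> C `<=` A -> fine (Q C) <= fine (P C).
  by move=> mC CA; rewrite -lee_fin !additive_law_fine//; exact: QP.
have PQ' C : measurable C -> C `<=` ~` A -> fine (P C) <= fine (Q C).
  by move=> mC CA; rewrite -lee_fin !additive_law_fine//; exact: PQ.
rewrite (additive_law_split Pl mB mA) (additive_law_split Ql mB mA).
rewrite (additive_law_split Pl mA mB) (additive_law_split Ql mA mB).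
have h1 := QP' _ (measurableI _ _ mB mA) (@subIsetr _ _ _).
have h2 := QP' _ (measurableD mA mB) (@subDsetl _ _ _).
have h3 : fine (P (B `\` A)) <= fine (Q (B `\` A)).
  by apply: PQ'; [exact: measurableD|move=> x []].
rewrite (setIC A B).
have h4 : fine (P (B `\` A)) + fine (P (~` A `\` B)) = 1 - fine (P A).
  rewrite -(additive_lawC Pl mA) (additive_law_split Pl (measurableC mA) mB).
  by rewrite setDE setIC.
have h5 : fine (Q (B `\` A)) + fine (Q (~` A `\` B)) = 1 - fine (Q A).
  rewrite -(additive_lawC Ql mA) (additive_law_split Ql (measurableC mA) mB).
  by rewrite setDE setIC.
have h6 : fine (P (~` A `\` B)) <= fine (Q (~` A `\` B)).
  by apply: PQ'; [apply: measurableD => //; exact: measurableC|move=> x []].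
rewrite (additive_law_split Pl mA mB) (setIC A B) in h4.
rewrite (additive_law_split Ql mA mB) (setIC A B) in h5.
by rewrite ler_norml; apply/andP; split; lra.
Qed.

Lemma measurable_lt_set (f g : T -> R) : measurable_fun setT f ->
  measurable_fun setT g -> measurable [set z | f z < g z].
Proof.
move=> mf mg; rewrite -[X in measurable X]setTI.
exact: (measurable_fun_ltr mf mg measurableT (Y := [set true])).
Qed.

Lemma density_le (nu : {measure set T -> \bar R}) f g P Q C :
  is_density nu f P -> is_density nu g Q -> measurable C ->
  (forall z, C z -> f z <= g z) -> (P C <= Q C)%E.
Proof.
move=> [mf f0 Pf] [mg g0 Qg] mC fg; rewrite Pf// Qg//.
apply: ge0_le_integral => //.
- by move=> x _; rewrite lee_fin.
- by apply/measurable_EFinP; exact: measurable_funTS.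
- by apply/measurable_EFinP; exact: measurable_funTS.
Qed.

Definition tv P Q : R := fine (tv_dist P Q).

Lemma tv_dist_leP P Q (x : R) : additive_law P -> additive_law Q ->
  (tv_dist P Q <= x%:E)%E <->
  forall A, measurable A -> `|fine (P A) - fine (Q A)| <= x.
Proof.
move=> Pl Ql; split.
  move=> h A mA; rewrite -lee_fin; apply: le_trans h.
  apply: ereal_sup_ubound; exists A => //=.
  by rewrite -(additive_law_fine Pl mA) -(additive_law_fine Ql mA) -EFinB abse_EFin.
move=> h; apply: ge_ereal_sup => _ [A mA <-].
rewrite -(additive_law_fine Pl mA) -(additive_law_fine Ql mA).
by rewrite -EFinB abse_EFin lee_fin h.
Qed.

Lemma tvE P Q : additive_law P -> additive_law Q ->
  tv_dist P Q = (tv P Q)%:E.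
Proof.
move=> Pl Ql; rewrite /tv fineK// ge0_fin_numE.
  apply: (@le_lt_trans _ _ 1%:E); last exact: ltry.
  apply/tv_dist_leP => // A mA.
  move: (additive_law_01 Pl mA) (additive_law_01 Ql mA) => /andP[? ?] /andP[? ?].
  by rewrite ler_norml; apply/andP; split; lra.
apply: ereal_sup_ubound => /=; exists set0 => //.
rewrite -(additive_law_fine Pl measurable0) -(additive_law_fine Ql measurable0).
rewrite -EFinB abse_EFin; congr EFin.
rewrite -(setCT) !additive_lawC//.
by case: Pl Ql => -> _ _ [-> _ _]; rewrite subrr normr0.
Qed.

Lemma tv_leP P Q (x : R) : additive_law P -> additive_law Q ->
  tv P Q <= x <->
  forall A, measurable A -> `|fine (P A) - fine (Q A)| <= x.
Proof. by move=> Pl Ql; rewrite -lee_fin -tvE//; exact: tv_dist_leP. Qed.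

Lemma tv_ub P Q A : additive_law P -> additive_law Q -> measurable A ->
  `|fine (P A) - fine (Q A)| <= tv P Q.
Proof. by move=> Pl Ql; move: A; apply/tv_leP. Qed.

Lemma tvC P Q : additive_law P -> additive_law Q -> tv P Q = tv Q P.
Proof.
move=> Pl Ql; apply/eqP; rewrite eq_le; apply/andP.
by split; apply/tv_leP => // A mA; rewrite distrC; exact: tv_ub.
Qed.

(** The reverse inequality at an event is the hypothesis at its complement. *)
Lemma tv_le_oneside P Q (x : R) : additive_law P -> additive_law Q ->
  (forall A, measurable A -> (P A <= Q A + x%:E)%E) -> tv P Q <= x.
Proof.
move=> Pl Ql h; apply/tv_leP => // A mA; apply/ler_normlP.
have := (additive_law_leD x Pl Ql mA).1 (h _ mA).
have mC := measurableC mA.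
have := (additive_law_leD x Pl Ql mC).1 (h _ mC).
rewrite !additive_lawC//; split; lra.
Qed.

Lemma tv_ge_event P Q A (x y : R) : additive_law P -> additive_law Q ->
  measurable A -> (x%:E <= P A)%E -> (Q A <= y%:E)%E -> x - y <= tv P Q.
Proof.
move=> Pl Ql mA xP Qy; apply: le_trans (tv_ub Pl Ql mA).
apply: le_trans (ler_norm _).
move: xP Qy; rewrite -(additive_law_fine Pl mA) -(additive_law_fine Ql mA).
rewrite !lee_fin; lra.
Qed.

Lemma tv_ge0 P Q : additive_law P -> additive_law Q -> 0 <= tv P Q.
Proof. by move=> Pl Ql; apply: le_trans (tv_ub Pl Ql measurable0). Qed.

Lemma tv_le1 P Q : additive_law P -> additive_law Q -> tv P Q <= 1.
Proof.
move=> Pl Ql; apply/tv_leP => // A mA.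
move: (additive_law_01 Pl mA) (additive_law_01 Ql mA) => /andP[? ?] /andP[? ?].
by rewrite ler_norml; apply/andP; split; lra.
Qed.

Lemma tv_triangle P Q S : additive_law P -> additive_law Q ->
  additive_law S -> tv P S <= tv P Q + tv Q S.
Proof.
move=> Pl Ql Sl; apply/tv_leP => // A mA.
have := tv_ub Pl Ql mA; have := tv_ub Ql Sl mA.
rewrite !ler_norml => /andP[? ?] /andP[? ?]; apply/andP; split; lra.
Qed.

(** Scheffé's identity: where f exceeds g each event is likelier under P, and
    elsewhere under Q, so no event separates the two laws better. *)
Lemma tv_density (nu : {measure set T -> \bar R}) f g P Q :
  is_density nu f P -> is_density nu g Q ->
  additive_law P -> additive_law Q ->
  let A := [set z | g z < f z] in
  measurable A /\ tv P Q = fine (P A) - fine (Q A).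
Proof.
move=> Pf Qg Pl Ql A; have [mf _ _] := Pf; have [mg _ _] := Qg.
have mA : measurable A by exact: measurable_lt_set.
split=> //; apply/eqP; rewrite eq_le; apply/andP; split; last first.
  by apply: le_trans (tv_ub Pl Ql mA); exact: ler_norm.
apply/tv_leP => // B mB; apply: scheffe_dist => // C mC CA.
  by apply: (density_le Qg Pf) => // z /CA /ltW.
by apply: (density_le Pf Qg) => // z /CA /negP; rewrite -leNgt.
Qed.

End finitely_additive.

(** * Normal laws on the line *)

Section normal.
Context {R : realType}.
Implicit Types (m a b sd x y : R) (B : set R).
Local Notation leb := (@lebesgue_measure R).

Lemma lebesgue_measure_addr a B : measurable B ->
  pushforward leb ((fun x => x + a) : _ -> measurableTypeR R) B = leb B.
Proof.
move=> mB; apply/esym/lebesgue_measure_unique => //=.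
  exact: measurable_funD.
move=> _ _ [[u v]] _ <-.
rewrite /pushforward/= (_ : _ @^-1` _ = `]u - a, v - a]%classic).
  by rewrite !lebesgue_measure_itv/= !lte_fin ltrD2r -!EFinB opprB addrA subrK.
by apply/seteqP; split => x; rewrite /= !in_itv/= ltrBlDr lerBrDr.
Qed.

Lemma normal_prob_shift m a sd B : sd != 0 -> measurable B ->
  normal_prob (m + a) sd B = normal_prob m sd [set x | B (x + a)].
Proof.
move=> sd0 mB; rewrite /normal_prob.
pose f := fun x : measurableTypeR R => (normal_pdf (m + a) sd x)%:E.
have mf : measurable_fun setT f.
  by apply/measurable_EFinP; exact: measurable_normal_pdf.
pose phi := (fun x => x + a) : measurableTypeR R -> measurableTypeR R.
have mphi : measurable_fun setT phi by exact: measurable_funD.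
transitivity (\int[pushforward leb phi]_(x in B) f x)%E.
  by apply: eq_measure_integral => //= A mA _; rewrite lebesgue_measure_addr.
rewrite ge0_integral_pushforward//=; last 2 first.
- exact: measurable_funTS.
- by move=> y _; rewrite lee_fin normal_pdf_ge0.
apply: eq_integral => x _.
by rewrite /f /= !normal_pdfE// /normal_fun opprD addrACA subrr addr0.
Qed.

Lemma normal_prob_ge m sd (l : R) a b : a <= b -> 0 <= l ->
  (forall x, a < x <= b -> l <= normal_pdf m sd x) ->
  ((l * (b - a))%:E <= normal_prob m sd `]a, b])%E.
Proof.
move=> ab l0 lpdf; rewrite /normal_prob.
apply: (@le_trans _ _ (\int[leb]_(x in `]a, b]) l%:E)%E).
  rewrite integral_cst//= lebesgue_measure_itv/= lte_fin.
  have [_|ba] := ltP a b; first by rewrite EFinM EFinB.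
  by rewrite mule0 lee_fin mulr_ge0_le0// subr_le0.
apply: ge0_le_integral => //=.
by apply/measurable_EFinP/measurable_funTS; exact: measurable_normal_pdf.
Qed.

Lemma normal_prob_le m sd a b : sd != 0 -> a <= b ->
  (normal_prob m sd `]a, b] <= (normal_peak sd * (b - a))%:E)%E.
Proof.
move=> sd0 ab; rewrite /normal_prob.
apply: (@le_trans _ _ (\int[leb]_(x in `]a, b]) (normal_peak sd)%:E)%E).
  apply: ge0_le_integral => //=.
  - by move=> x _; rewrite lee_fin normal_pdf_ge0.
  - by apply/measurable_EFinP/measurable_funTS; exact: measurable_normal_pdf.
  - by move=> x _; rewrite lee_fin normal_pdf_ub.
rewrite integral_cst//= lebesgue_measure_itv/= lte_fin.
have [_|ba] := ltP a b; first by rewrite EFinM EFinB.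
by rewrite mule0 lee_fin mulr_ge0 ?normal_peak_ge0 ?subr_ge0.
Qed.

Lemma normal_prob_density m sd :
  is_density leb (normal_pdf m sd) (normal_prob m sd).
Proof.
split=> //; first exact: measurable_normal_pdf.
by move=> z; exact: normal_pdf_ge0.
Qed.

Let N m sd := additive_law_probability (normal_prob m sd).

Lemma normal_pdf_le a b sd x : 0 < sd -> `|x - b| <= `|x - a| ->
  normal_pdf a sd x <= normal_pdf b sd x.
Proof.
move=> sd0 h; rewrite !normal_pdfE ?gt_eqF//.
rewrite ler_wpM2l ?normal_peak_ge0// /normal_fun ler_expR !mulNr lerN2.
rewrite ler_pM2r ?invr_gt0 ?pmulrn_lgt0 ?exprn_gt0//.
rewrite -(real_normK (num_real (x - b))) -(real_normK (num_real (x - a))).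
by rewrite lerXn2r ?nnegrE.
Qed.

(** The density with the smaller mean is the larger one on the half-line up to
    the midpoint c. By translation, the masses that the two laws give to this
    half-line differ by the mass of an interval of length |a - b|. *)
Lemma normal_tv_le a b sd : 0 < sd ->
  tv (normal_prob a sd) (normal_prob b sd) <= normal_peak sd * `|a - b|.
Proof.
move=> sd0; have sdn0 : sd != 0 by rewrite gt_eqF.
wlog ab : a b / a <= b.
  move=> H; have [/H//|/ltW/H] := leP a b.
  by rewrite (tvC (N _ _) (N _ _)) distrC.
set c := (a + b) / 2; set A := `]-oo, c]%classic : set R.
have mA : measurable A by exact: measurable_itv.
apply: (@le_trans _ _ (fine (normal_prob a sd A) - fine (normal_prob b sd A))).
  apply/tv_leP => [||B mB]; [exact: N|exact: N|].
  apply: (scheffe_dist (N a sd) (N b sd) mA mB) => C mC CA.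
  - apply: (density_le (normal_prob_density _ _) (normal_prob_density _ _)) => //.
    move=> z /CA; rewrite /A/= in_itv/= /c => zc; apply: normal_pdf_le => //.
    have -> : `|z - b| = b - z by rewrite ler0_norm; lra.
    by rewrite ler_norml; apply/andP; split; lra.
  - apply: (density_le (normal_prob_density _ _) (normal_prob_density _ _)) => //.
    move=> z /CA; rewrite /A/= in_itv/= => /negP; rewrite -ltNge /c => zc.
    apply: normal_pdf_le => //.
    have -> : `|z - a| = z - a by rewrite ger0_norm; lra.
    by rewrite ler_norml; apply/andP; split; lra.
have -> : normal_prob b sd A = normal_prob a sd `]-oo, c - (b - a)]%classic.
  rewrite -[in LHS](subrK a b) addrC normal_prob_shift//; congr normal_prob.
  by apply/seteqP; split => x; rewrite /A /= !in_itv/= lerBrDr.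
have -> : `]-oo, c - (b - a)]%classic = A `&` `]-oo, c - (b - a)]%classic.
  by apply/esym/setIidr => x; rewrite /A /= !in_itv/= => h; lra.
rewrite (additive_law_split (N a sd) mA (measurable_itv `]-oo, c - (b - a)])).
rewrite addrC addKr (_ : A `\` _ = `]c - (b - a), c]%classic).
  have := @normal_prob_le a sd (c - (b - a)) c sdn0.
  rewrite -[X in (X <= _)%E](additive_law_fine (N a sd))// lee_fin.
  rewrite (_ : `|a - b| = b - a); last by rewrite ler0_norm; lra.
  have -> : c - (c - (b - a)) = b - a by ring.
  by apply; lra.
apply/seteqP; split => x; rewrite /A /= !in_itv/=.
  by move=> [-> /negP]; rewrite -ltNge => ->.
by move=> /andP[h ->]; split=> //; apply/negP; rewrite -ltNge.
Qed.

Lemma normal_peak_le sd : 0 < sd -> normal_peak sd * sd <= 2^-1.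
Proof.
move=> sd0; rewrite /normal_peak -mulr_natr -mulrA sqrtrM ?sqr_ge0//.
rewrite sqrtr_sqr gtr0_norm// invfM mulrAC mulVf ?gt_eqF// mul1r.
rewrite lef_pV2 ?posrE// ?sqrtr_gt0 ?mulr_gt0 ?pi_gt0//.
rewrite -(ler_pXn2r (n := 2)) ?nnegrE ?sqrtr_ge0// sqr_sqrtr.
  by have := @pi_ge2 R; lra.
by rewrite mulr_ge0 ?pi_ge0.
Qed.

(** The density agrees almost everywhere with the Radon-Nikodym derivative, for
    which this is the change of variables. *)
Lemma ge0_integral_normal_prob m sd (f : R -> \bar R) :
  measurable_fun setT f -> (forall x, 0 <= f x)%E ->
  (\int[normal_prob m sd]_x f x = \int[leb]_x (f x * (normal_pdf m sd x)%:E))%E.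
Proof.
move=> mf f0.
have dom : normal_prob m sd `<< leb by exact: normal_prob_dominates.
rewrite -(Radon_Nikodym_SigmaFinite.change_of_variables dom f0 measurableT mf).
apply: ae_eq_integral => //.
- apply: emeasurable_funM => //; apply: (measurable_int leb).
  exact: Radon_Nikodym_SigmaFinite.f_integrable.
- apply: emeasurable_funM => //; apply/measurable_EFinP.
  exact: measurable_normal_pdf.
- apply: ae_eqe_mul2l => /=; apply: integral_ae_eq => //.
  + exact: Radon_Nikodym_SigmaFinite.f_integrable.
  + by apply/measurable_EFinP; exact: measurable_normal_pdf.
  + by move=> E _ mE; rewrite -Radon_Nikodym_SigmaFinite.f_integral.
Qed.

(** Doubling the variance leaves a factor exp(- u² / 4 v²) to absorb |u|, since
    z <= 1 + z² / 4 <= exp(z² / 4). This bounds the first absolute moment by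
    the total mass of another normal law. *)
Lemma normal_pdf_abs_le (v u : R) : 0 < v ->
  `|u| * normal_pdf 0 v u <= 2 * v * normal_pdf 0 (Num.sqrt 2 * v) u.
Proof.
move=> v0; have v20 : 0 < Num.sqrt 2 * v by rewrite mulr_gt0 ?sqrtr_gt0.
have v2 : 0 < v ^+ 2 by rewrite exprn_gt0.
rewrite !normal_pdfE ?gt_eqF//.
set w := normal_fun 0 (Num.sqrt 2 * v) u.
have w0 : 0 < w by exact: expR_gt0.
have wE : normal_fun 0 v u = w * w.
  rewrite /w /normal_fun -expRD; congr expR.
  rewrite !subr0 exprMn sqr_sqrtr// (mulr2n (v ^+ 2)) (mulr2n (2 * v ^+ 2)).
  by field; apply/andP; split; rewrite gt_eqF//; lra.
have uw : `|u| * w <= v.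
  have : `|u| / v <= w^-1.
    rewrite /w /normal_fun -expRN; apply: le_trans (expR_ge1Dx _).
    rewrite subr0 exprMn sqr_sqrtr// -(real_normK (num_real u)).
    rewrite (mulr2n (2 * v ^+ 2)) -subr_ge0.
    have -> : 1 + - (- `|u| ^+ 2 / (2 * v ^+ 2 + 2 * v ^+ 2)) - `|u| / v =
        (1 - `|u| / v / 2) ^+ 2.
      field; apply/andP; split; rewrite gt_eqF//; lra.
    exact: sqr_ge0.
  by rewrite ler_pdivrMr// mulrC ler_pdivlMr// => h.
have -> : normal_peak v = Num.sqrt 2 * normal_peak (Num.sqrt 2 * v).
  rewrite /normal_peak exprMn sqr_sqrtr//.
  have -> : 2 * v ^+ 2 * pi *+ 2 = 2 * (v ^+ 2 * pi *+ 2).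
    by rewrite mulrnAr mulrA.
  rewrite sqrtrM// invfM mulrA divff ?mul1r//.
have s2 : Num.sqrt 2 <= 2 :> R.
  rewrite -(ler_pXn2r (n := 2)) ?nnegrE ?sqrtr_ge0// sqr_sqrtr//; lra.
have pk := normal_peak_ge0 (Num.sqrt 2 * v).
rewrite wE; set pp := normal_peak _ in pk *.
have -> : `|u| * (Num.sqrt 2 * pp * (w * w)) =
  (Num.sqrt 2 * (`|u| * w)) * (pp * w) by ring.
apply: ler_wpM2r; first by rewrite mulr_ge0// ltW.
by apply: ler_pM => //; rewrite mulr_ge0// ltW.
Qed.

Lemma normal_abs_moment (v : R) : 0 < v ->
  (\int[normal_prob (0 : R) v]_u (`|u|)%:E <= (2 * v)%:E)%E.
Proof.
move=> v0.
have v20 : 0 < Num.sqrt 2 * v by rewrite mulr_gt0 ?sqrtr_gt0.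
rewrite ge0_integral_normal_prob//; last first.
  by apply/measurable_EFinP; exact: normr_measurable.
apply: (@le_trans _ _ (\int[leb]_u
    ((2 * v)%:E * (normal_pdf 0 (Num.sqrt 2 * v) u)%:E))%E); last first.
  rewrite ge0_integralZl_EFin//=.
  - by rewrite integral_normal_pdf mule1.
  - by move=> x _; rewrite lee_fin normal_pdf_ge0.
  - by apply/measurable_EFinP; exact: measurable_normal_pdf.
  - by rewrite mulr_ge0// ltW.
apply: ge0_le_integral => //=.
- by move=> x _; rewrite mule_ge0// lee_fin normal_pdf_ge0.
- apply: emeasurable_funM; first by apply/measurable_EFinP.
  by apply/measurable_EFinP; exact: measurable_normal_pdf.
- apply: emeasurable_funM => //.
  by apply/measurable_EFinP; exact: measurable_normal_pdf.
by move=> u _; rewrite -!EFinM lee_fin normal_pdf_abs_le.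
Qed.

Lemma normal_peak_scale (s : R) : 0 < s -> normal_peak s = normal_peak 1 / s.
Proof.
move=> s0; rewrite /normal_peak expr1n mul1r -mulrnAr sqrtrM ?sqr_ge0//.
by rewrite sqrtr_sqr gtr0_norm// invfM mulrC.
Qed.

(** Used next to the mean (g = 0) and one deviation above it (g = h = s). In
    both cases the density is at least its value at l deviations. *)
Lemma normal_prob_itv (m s g h l : R) :
  0 < s -> 0 <= g -> 0 <= h -> g + h <= l * s ->
  ((normal_peak 1 * expR (- (l ^+ 2 / 2)) * (h / s))%:E <=
    normal_prob m s `](m + g)%R, (m + g + h)%R]%classic)%E.
Proof.
move=> s0 g0 h0 ghl.
have -> : normal_peak 1 * expR (- (l ^+ 2 / 2)) * (h / s) =
    (normal_peak s * expR (- (l ^+ 2 / 2))) * (m + g + h - (m + g)).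
  by rewrite (normal_peak_scale s0); field; rewrite gt_eqF.
apply: normal_prob_ge; first by rewrite lerDl.
  by rewrite mulr_ge0 ?normal_peak_ge0 ?expR_ge0.
move=> x /andP[x1 x2]; rewrite normal_pdfE ?gt_eqF//.
rewrite ler_wpM2l ?normal_peak_ge0// /normal_fun ler_expR mulNr lerN2.
rewrite (_ : s ^+ 2 *+ 2 = s ^+ 2 * 2); last by rewrite mulr2n; ring.
rewrite invfM mulrA ler_pM2r ?invr_gt0// ler_pdivrMr ?exprn_gt0// -exprMn.
by rewrite lerXn2r ?nnegrE; lra.
Qed.

End normal.

(** * Total variation between regression laws *)

Section regression.
Context {R : realType} {p : nat}.
Implicit Types (theta u : 'cV[R]_p) (E : set (p.-tuple R * R)).

Lemma inner_sub (x : p.-tuple R) theta u :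
  inner x (theta - u) = inner x theta - inner x u.
Proof.
by rewrite /inner -sumrB; apply: eq_bigr => i _; rewrite !mxE mulrBr.
Qed.

Lemma measurable_inner u :
  measurable_fun setT (fun x : p.-tuple R => inner x u).
Proof.
apply: measurable_sum => i; apply: measurable_funM => //.
exact: measurable_tnth.
Qed.

(** By Fubini's theorem for the joint density restricted to E, whose integral
    over y is the mass of the section of E at x. *)
Lemma measurable_normal_kernel (sigma : R) theta E : sigma != 0 ->
  measurable E ->
  measurable_fun setT
    (fun x => normal_prob (inner x theta) sigma (xsection E x)).
Proof.
move=> s0 mE.
pose f (z : p.-tuple R * R) : R :=
  normal_pdf (inner z.1 theta) sigma z.2.
have mf : measurable_fun setT f.
  rewrite (_ : f = (fun z => normal_peak sigma *
      expR (- (z.2 - inner z.1 theta) ^+ 2 / (sigma ^+ 2 *+ 2)))); last first.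
    by apply/funext => z; rewrite /f normal_pdfE.
  apply: measurable_funM => //; apply: measurableT_comp => //.
  apply: measurable_funM => //; apply: measurableT_comp => //.
  apply: measurable_funX; apply: measurable_funB => //.
  exact: (measurableT_comp (measurable_inner theta) measurable_fst).
have mfE : measurable_fun setT (EFin \o f) by exact/measurable_EFinP.
pose g := (EFin \o f) \_ E.
have mg : measurable_fun setT g.
  exact: (measurable_restrictT (EFin \o f) mE).1 (measurable_funTS mfE).
have g0 z : (0 <= g z)%E.
  by apply: erestrict_ge0 => y _; rewrite lee_fin normal_pdf_ge0.
have := @measurable_fun_fubini_tonelli_F _ _ _ _ _ (@lebesgue_measure R) _ mg g0.
congr measurable_fun; apply/funext => x.
rewrite /fubini_F /normal_prob [RHS]integral_mkcond.
apply: eq_integral => y _; rewrite /g !patchE.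
by rewrite -mem_xsection.
Qed.

Lemma additive_law_regression (mu : probability (p.-tuple R) R) (sigma : R)
  theta : sigma != 0 -> additive_law (regression_law mu sigma theta).
Proof.
move=> s0; rewrite /regression_law; split.
- rewrite -[RHS](probability_setT mu) -[RHS]mul1e -integral_cst//.
  apply: eq_integral => x _.
  by rewrite (_ : xsection _ _ = setT) ?probability_setT// xsectionE.
- by move=> A mA; apply: integral_ge0.
- move=> A B mA mB; rewrite -ge0_integralD//; last 2 first.
  + by apply: measurable_normal_kernel => //; exact: measurableI.
  + by apply: measurable_normal_kernel => //; exact: measurableD.
  apply: eq_integral => x _; rewrite xsectionI xsectionD.
  have [_ _] := additive_law_probability (normal_prob (inner x theta) sigma).
  by apply; exact: measurable_xsection.
Qed.

End regression.

Section regression_tv.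
Context {R : realType} {p : nat}.
Variables (Sigma : 'M[R]_p) (mu : probability (p.-tuple R) R).
Hypothesis hmu : centered_gaussian Sigma mu.
Variable sigma : R.
Hypothesis sigma_gt0 : 0 < sigma.
Implicit Types theta u : 'cV[R]_p.

Let sigma_neq0 : sigma != 0. Proof. by rewrite gt_eqF. Qed.
Local Notation sdev u := (Num.sqrt (quad_form Sigma u)).
Local Notation P theta := (regression_law mu sigma theta).

(** The law of [inner x u] is prescribed on Borel sets, so the integral can be
    computed under N(0, v²), or under a Dirac mass when v = 0. *)
Lemma gaussian_abs_moment u :
  (\int[mu]_x (`|inner x u|)%:E <= (2 * sdev u)%:E)%E.
Proof.
have mu_u := @measurable_inner R p u.
pose phi : p.-tuple R -> measurableTypeR R := fun x => inner x u.
have mphi : measurable_fun setT phi by [].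
pose f : measurableTypeR R -> \bar R := fun y => (`|y|)%:E.
have mf : measurable_fun setT f.
  by apply/measurable_EFinP; exact: normr_measurable.
have -> : (\int[mu]_x (`|inner x u|)%:E = \int[pushforward mu phi]_y f y)%E.
  by rewrite ge0_integral_pushforward// => y _; rewrite lee_fin.
have [s0|s0] := eqVneq (sdev u) 0.
  have -> : (\int[pushforward mu phi]_y f y =
             \int[\d_(0%R : measurableTypeR R)]_y f y)%E.
    apply: eq_measure_integral => //= A mA _.
    by rewrite /pushforward/= [LHS]hmu// /normal_law s0 eqxx.
  by rewrite integral_dirac// s0 mulr0 /f normr0 mule0.
have -> : (\int[pushforward mu phi]_y f y =
           \int[normal_prob 0%R (sdev u)]_y f y)%E.
  apply: eq_measure_integral => //= A mA _.
  by rewrite /pushforward/= [LHS]hmu// /normal_law (negbTE s0).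
by apply: normal_abs_moment; rewrite lt_neqAle eq_sym s0 sqrtr_ge0.
Qed.

(** Given X, the two laws of y are normal with means X^T(θ - θ') apart; their
    distance is integrated over X. *)
Lemma regression_tv_le theta theta' :
  tv (P theta) (P theta') <= sdev (theta - theta') / sigma.
Proof.
have Pl t : additive_law (P t) by exact: additive_law_regression.
apply: tv_le_oneside => // E mE.
have pk0 := normal_peak_ge0 sigma.
apply: (@le_trans _ _ (P theta' E + (normal_peak sigma)%:E *
    \int[mu]_x (`|inner x (theta - theta')|)%:E)%E).
  rewrite /regression_law -ge0_integralZl_EFin//; last first.
    by apply/measurable_EFinP; apply: measurableT_comp => //; exact: measurable_inner.
  rewrite -ge0_integralD//; first last.
  - apply: emeasurable_funM => //; apply/measurable_EFinP.
    by apply: measurableT_comp => //; exact: measurable_inner.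
  - by move=> x _; rewrite mule_ge0// lee_fin.
  - exact: measurable_normal_kernel.
  apply: ge0_le_integral => //.
  - exact: measurable_normal_kernel.
  - apply: emeasurable_funD; first exact: measurable_normal_kernel.
    apply: emeasurable_funM => //; apply/measurable_EFinP.
    by apply: measurableT_comp => //; exact: measurable_inner.
  move=> x _; have mx : measurable (xsection E x) by exact: measurable_xsection.
  have N a := additive_law_probability (normal_prob a sigma).
  rewrite -EFinM; apply/(additive_law_leD _ (N _) (N _) mx).
  rewrite inner_sub.
  rewrite -lerBlDl; apply: le_trans (ler_norm _) _.
  apply: le_trans (tv_ub (N (inner x theta)) (N (inner x theta')) mx) _.
  exact: normal_tv_le.
rewrite leeD2l//; apply: (@le_trans _ _
    ((normal_peak sigma)%:E * (2 * sdev (theta - theta'))%:E)%E).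
  by rewrite lee_wpmul2l ?lee_fin// gaussian_abs_moment.
rewrite -EFinM lee_fin ler_pdivlMr//.
have := normal_peak_le sigma_gt0; have := sqrtr_ge0 (quad_form Sigma (theta - theta')).
set v := Num.sqrt _; set k := normal_peak _.
by move=> v0 kh; have := ler_wpM2r v0 kh; lra.
Qed.

(** The product of φ(0) exp(- T² / 2), a lower bound of the standard normal
    density on [0, T], and of φ(0) exp(- 2), a lower bound of the standard
    normal mass beyond 1. *)
Definition tv_sep (T : R) : R :=
  normal_peak 1 ^+ 2 * expR (- (2 + T ^+ 2 / 2)).

(** The separating event asks that X^T(θ - θ') exceed its own deviation v, and
    that y exceed X^Tθ. The first condition has probability at least a
    constant. Under it, the second one is the half-line above the mean for θ,
    while for θ' it misses an interval of length at least v above the mean. *)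
Lemma regression_tv_ge T theta theta' :
  sdev (theta - theta') <= T * sigma ->
  tv_sep T * (sdev (theta - theta') / sigma) <= tv (P theta) (P theta').
Proof.
set v := sdev _ => vT.
have Pl t : additive_law (P t) by exact: additive_law_regression.
have [v0|v_gt0] := leP v 0.
  have -> : v = 0 by apply/eqP; rewrite eq_le v0 sqrtr_ge0.
  by rewrite mul0r mulr0 tv_ge0.
pose Dx := [set x : p.-tuple R | v < inner x (theta - theta')].
pose E := [set z : p.-tuple R * R | v < inner z.1 (theta - theta')] `&`
          [set z | inner z.1 theta < z.2].
have mE2 : measurable [set z : p.-tuple R * R | inner z.1 theta < z.2].
  apply: measurable_lt_set => //.
  exact: (measurableT_comp (measurable_inner theta) measurable_fst).
have mDx : measurable Dx by apply: measurable_lt_set => //; exact: measurable_inner.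
have mE : measurable E.
  have mi u : measurable_fun setT (fun z : p.-tuple R * R => inner z.1 u).
    exact: (measurableT_comp (measurable_inner u) measurable_fst).
  by apply: measurableI => //; apply: measurable_lt_set.
(* the mass above the mean, whatever the mean *)
pose h := fine (normal_prob 0 sigma `]0, +oo[).
pose q := normal_peak 1 * expR (- (T ^+ 2 / 2)) * (v / sigma).
have N a := additive_law_probability (normal_prob a sigma).
have xE x : Dx x -> xsection E x = `]inner x theta, +oo[%classic.
  move=> xD; apply/seteqP; split => y; rewrite xsectionE /E/= in_itv/= andbT.
    by case.
  by move=> ?; split.
have xE0 x : ~ Dx x -> xsection E x = set0.
  by move=> xD; apply/seteqP; split => y; rewrite xsectionE /E//= => -[].
have PE t : P t E = (\int[mu]_(x in Dx)
    normal_prob (inner x t) sigma `]inner x theta, +oo[%classic)%E.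
  rewrite /regression_law [RHS]integral_mkcond; apply: eq_integral => x _.
  rewrite patchE; case: ifPn => [/set_mem xD|/negP xD]; first by rewrite xE.
  by rewrite xE0 ?measure0// => /mem_set.
have shift m : normal_prob m sigma `]m, +oo[%classic = h%:E.
  have mI : measurable (`]0, +oo[%classic : set R) by [].
  rewrite /h (additive_law_fine (N 0) mI).
  have := normal_prob_shift 0 m sigma_neq0 (measurable_itv `]m, +oo[).
  rewrite add0r => ->; congr normal_prob.
  by apply/seteqP; split => y; rewrite /= !in_itv/= !andbT ltrDr.
have Ph : P theta E = (h%:E * mu Dx)%E.
  by rewrite PE -integral_cst//; apply: eq_integral => x _; rewrite shift.
have Phq : (P theta' E <= (h - q)%:E * mu Dx)%E.
  rewrite PE -integral_cst//; apply: ge0_le_integral => //.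
  - apply: measurable_funTS.
    have := measurable_normal_kernel theta' sigma_neq0 mE2.
    congr measurable_fun; apply/funext => x; congr normal_prob.
    by apply/seteqP; split => y; rewrite xsectionE /= in_itv/= andbT.
  move=> x xD; set m := inner x theta'.
  have mm : m + v <= inner x theta by move: xD; rewrite /Dx/= inner_sub -/m; lra.
  set b := inner x theta in mm *.
  have mb : (q%:E <= normal_prob m sigma `]m, b]%classic)%E.
    apply: (@le_trans _ _
        (normal_prob m sigma `](m + 0)%R, (m + 0 + v)%R]%classic)%E).
      by apply: normal_prob_itv => //; rewrite ?add0r// ltW.
    apply: le_measure; rewrite ?inE// addr0.
    by move=> y; rewrite /= !in_itv/= => /andP[-> /le_trans]; apply.
  have split_tail : (h%:E = normal_prob m sigma `]m, b]%classic +
      normal_prob m sigma `]b, +oo[%classic)%E.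
    rewrite -(shift m) -measureU//.
      congr normal_prob; apply/seteqP; split => y; rewrite /= !in_itv/= !andbT.
        by move=> my; have [yb|by_] := leP y b; [left; rewrite my|right].
      by move=> [/andP[]//|by_]; lra.
    by apply/seteqP; split => // y; rewrite /= !in_itv/= andbT => -[]; lra.
  rewrite EFinB leeBrDr// split_tail addeC.
  by rewrite leeD2r.
have muDx : ((normal_peak 1 * expR (- 2))%:E <= mu Dx)%E.
  have -> : mu Dx = normal_prob 0 v `]v, +oo[%classic.
    rewrite [RHS](_ : _ = normal_law 0 v `]v, +oo[); last first.
      by rewrite /normal_law gt_eqF.
    rewrite -hmu//; congr (mu _).
    by apply/seteqP; split => x; rewrite /Dx/= in_itv/= andbT.
  apply: (@le_trans _ _ (normal_prob 0 v `](0 + v)%R, (0 + v + v)%R]%classic)%E).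
    apply: le_trans (normal_prob_itv (l := 2) _ _ _ _ _) => //; try exact: ltW.
      rewrite lee_fin divff ?gt_eqF// mulr1 ler_wpM2l ?normal_peak_ge0//.
      by rewrite ler_expR; lra.
    by lra.
  apply: le_measure; rewrite ?inE//.
  by move=> x; rewrite /= !in_itv/= add0r andbT => /andP[].
have [d d1 dE] : exists2 d : R, normal_peak 1 * expR (- 2) <= d & mu Dx = d%:E.
  exists (fine (mu Dx)); last by rewrite fineK// fin_num_measure.
  by rewrite -lee_fin fineK// fin_num_measure.
rewrite dE -EFinM in Ph; rewrite dE -EFinM in Phq.
have := tv_ge_event (Pl theta) (Pl theta') mE _ Phq.
rewrite Ph => /(_ (h * d) (lexx _)); apply: le_trans.
have -> : h * d - (h - q) * d = q * d by ring.
have -> : tv_sep T * (v / sigma) = q * (normal_peak 1 * expR (- 2)).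
  rewrite /tv_sep /q opprD expRD; ring.
apply: ler_wpM2l => //.
by rewrite /q !mulr_ge0 ?normal_peak_ge0 ?expR_ge0 ?invr_ge0 ?ltW.
Qed.

End regression_tv.

(** * Sparse vectors and sparse eigenvalues *)

Section euclidean.
Context {R : realType} {p : nat}.
Implicit Types (u v w : 'cV[R]_p) (S Sigma : 'M[R]_p).

Lemma enorm_ge0 v : 0 <= enorm v. Proof. exact: sqrtr_ge0. Qed.

Lemma sqr_enorm v : enorm v ^+ 2 = \sum_i v i 0 ^+ 2.
Proof. by rewrite sqr_sqrtr// sumr_ge0// => i _; exact: sqr_ge0. Qed.

Lemma enormZ (a : R) v : enorm (a *: v) = `|a| * enorm v.
Proof.
rewrite /enorm -sqrtr_sqr -sqrtrM ?sqr_ge0// mulr_sumr; congr Num.sqrt.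
by apply: eq_bigr => i _; rewrite mxE exprMn.
Qed.

Lemma enormN v : enorm (- v) = enorm v.
Proof. by rewrite -scaleN1r enormZ normrN1 mul1r. Qed.

Lemma enorm_eq0 v : enorm v = 0 -> v = 0.
Proof.
move=> v0; apply/colP => i; rewrite mxE; apply/eqP.
rewrite -sqrf_eq0 eq_le sqr_ge0 andbT.
apply: (@le_trans _ _ (enorm v ^+ 2)); last by rewrite v0 expr0n.
by rewrite sqr_enorm (bigD1 i)//= lerDl sumr_ge0// => j _; exact: sqr_ge0.
Qed.

Lemma enorm0 : enorm (0 : 'cV[R]_p) = 0.
Proof. by rewrite -(scale0r 0) enormZ normr0 mul0r. Qed.

(** The triangle inequality, from (x + y)² <= (1 + b / a) x² + (1 + a / b) y²
    in each coordinate with a and b the two norms. *)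
Lemma enormD u v : enorm (u + v) <= enorm u + enorm v.
Proof.
have [u0|u_gt0] := leP (enorm u) 0.
  have /enorm_eq0 -> : enorm u = 0 by apply/eqP; rewrite eq_le u0 enorm_ge0.
  by rewrite enorm0 !add0r.
have [v0|v_gt0] := leP (enorm v) 0.
  have /enorm_eq0 -> : enorm v = 0 by apply/eqP; rewrite eq_le v0 enorm_ge0.
  by rewrite enorm0 !addr0.
rewrite -(ler_pXn2r (n := 2)) ?nnegrE ?enorm_ge0 ?addr_ge0 ?enorm_ge0//.
set a := enorm u in u_gt0 *; set b := enorm v in v_gt0 *.
apply: (@le_trans _ _ (\sum_i ((1 + b / a) * u i 0 ^+ 2 +
                               (1 + a / b) * v i 0 ^+ 2))).
  rewrite sqr_enorm; apply: ler_sum => i _; rewrite mxE -subr_ge0.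
  have -> : (1 + b / a) * u i 0 ^+ 2 + (1 + a / b) * v i 0 ^+ 2 -
      (u i 0 + v i 0) ^+ 2 = (b * u i 0 - a * v i 0) ^+ 2 / (a * b).
    by field; rewrite !gt_eqF.
  by rewrite divr_ge0 ?sqr_ge0// mulr_ge0// ltW.
rewrite big_split/= -!mulr_sumr -!sqr_enorm -/a -/b.
by rewrite le_eqVlt; apply/orP; left; apply/eqP; field; rewrite !gt_eqF.
Qed.

Lemma sqrt_quad_form Sigma S v : is_psd_sqrt Sigma S ->
  Num.sqrt (quad_form Sigma v) = enorm (S *m v).
Proof.
move=> [[St _] SS]; rewrite /quad_form -SS /enorm; congr Num.sqrt.
rewrite !mulmxA -mulmxA -{1}St -trmx_mul mxE; apply: eq_bigr => i _.
by rewrite mxE expr2.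
Qed.

Lemma supp_sub u v : supp (u - v) \subset supp u :|: supp v.
Proof.
apply/fintype.subsetP => i; rewrite !inE !mxE; apply: contraNT.
by rewrite negb_or !negbK => /andP[/eqP-> /eqP->]; rewrite subr0.
Qed.

Lemma card_supp_sub u v : (#|supp (u - v)| <= #|supp u| + #|supp v|)%N.
Proof.
apply: leq_trans (subset_leq_card (supp_sub u v)) _.
by rewrite cardsU leq_subr.
Qed.

(** Take for w the indicator of k - |supp v| coordinates outside the support. *)
Lemma supp_perturb (k : nat) v : (#|supp v| <= k <= p)%N ->
  exists w, forall t : R, 0 < t -> #|supp (v + t *: w)| = k.
Proof.
move=> /andP[vk kp].
have [B /andP[vB Bk]] : exists B : {set 'I_p}, (supp v \subset B) && (#|B| == k).
  have : (k - #|supp v| <= #|~: supp v|)%N.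
    by rewrite leq_subLR cardsC card_ord.
  move=> /card_geqP[s' [us' ss' sub]].
  exists (supp v :|: [set x in s']).
  rewrite finset.subsetUl cardsU (_ : supp v :&: _ = finset.set0).
    by rewrite cards0 subn0 [X in (_ + X)%N]cardsE (card_uniqP us') ss' subnKC//=.
  apply/finset.setP => x; rewrite !inE; apply/negP => /andP[xv /sub].
  by rewrite !inE xv.
exists (\col_i (if (i \in B) && (i \notin supp v) then 1 else 0)) => t t0.
rewrite -(eqP Bk); apply: eq_card => i; rewrite !inE !mxE !inE.
have := fintype.subsetP vB i; rewrite !inE; case: eqP => [->|/eqP vi0] /=.
  move=> _; rewrite andbT add0r; case: (i \in B); rewrite ?mulr1 ?mulr0 ?eqxx//.
  by rewrite gt_eqF.
by move=> /(_ isT) ->; rewrite /= mulr0 addr0 vi0.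
Qed.

(** The ratios are controlled on supports of size exactly k only; a sparser
    vector v is the limit of the vectors v + t w of [supp_perturb] as t
    decreases to 0. *)
Lemma sparse_stretch S (k : nat) (a b : R) v :
  (a%:E <= ereal_inf (stretch_ratios S k))%E ->
  (ereal_sup (stretch_ratios S k) <= b%:E)%E ->
  0 <= a -> 0 <= b ->
  (#|supp v| <= k <= p)%N ->
  a * enorm v <= enorm (S *m v) <= b * enorm v.
Proof.
move=> hinf hsup a0 b0 hk; have [w hw] := supp_perturb hk.
have exact_k u : #|supp u| = k ->
    a * enorm u <= enorm (S *m u) <= b * enorm u.
  move=> uk; have [u0|u0] := eqVneq (enorm u) 0.
    by rewrite (enorm_eq0 u0) mulmx0 enorm0 !mulr0 lexx.
  have u_gt0 : 0 < enorm u by rewrite lt_neqAle eq_sym u0 enorm_ge0.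
  have ratio : stretch_ratios S k (enorm (S *m u) / enorm u)%:E by exists u.
  rewrite -(ler_pdivlMr _ _ u_gt0) -(ler_pdivrMr _ _ u_gt0).
  apply/andP; split; rewrite -lee_fin.
    by apply: le_trans hinf _; exact: ereal_inf_lbound.
  by apply: le_trans _ hsup; exact: ereal_sup_ubound.
have lim x y z : (forall t : R, 0 < t -> x <= y + t * z) -> 0 <= z -> x <= y :> R.
  move=> h z0; apply/ler_addgt0Pr => e e0.
  have z1 : 0 < z + 1 by rewrite ltr_wpDl.
  apply: le_trans (h (e / (z + 1)) _) _; first by rewrite divr_gt0.
  rewrite lerD2l mulrAC ler_pdivrMr// ler_pM2l//; lra.
have Sw t : S *m (v + t *: w) = S *m v + t *: (S *m w).
  by rewrite mulmxDr -scalemxAr.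
apply/andP; split.
- apply: (lim _ _ (enorm (S *m w) + a * enorm w)) => [t t0|]; last first.
    by rewrite addr_ge0 ?mulr_ge0 ?enorm_ge0.
  have /andP[+ _] := exact_k _ (hw _ t0); rewrite Sw => h.
  have h1 := enormD (S *m v) (t *: (S *m w)).
  have h2 := enormD (v + t *: w) (- (t *: w)).
  rewrite addrK enormN enormZ (gtr0_norm t0) in h2.
  rewrite enormZ (gtr0_norm t0) in h1.
  have := ler_wpM2l a0 h2; lra.
- apply: (lim _ _ (enorm (S *m w) + b * enorm w)) => [t t0|]; last first.
    by rewrite addr_ge0 ?mulr_ge0 ?enorm_ge0.
  have /andP[_] := exact_k _ (hw _ t0); rewrite Sw => h.
  have h1 := enormD (S *m v + t *: (S *m w)) (- (t *: (S *m w))).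
  have h2 := enormD v (t *: w).
  rewrite addrK enormN enormZ (gtr0_norm t0) in h1.
  rewrite enormZ (gtr0_norm t0) in h2.
  have := ler_wpM2l b0 h2; lra.
Qed.

End euclidean.

(** * Counting quantized sparse vectors *)

Section codes.
Context {R : realType}.

(** What is recorded of a coordinate: nothing if it vanishes, otherwise the sign
    and the truncated absolute value of its normalized offset from a center. *)
Definition cell (K : nat) : finType := option (bool * 'I_K.+1).

Definition cell_supp K (c : cell K) : nat := isSome c.
Definition cell_size K (c : cell K) : nat := if c is Some (_, k) then k else 0.

Definition cheap_codes (p s K : nat) : {set {ffun 'I_p -> cell K}} :=
  [set f : {ffun 'I_p -> cell K} | (\sum_i cell_supp (f i) <= s)%N &&
             (\sum_i cell_size (f i) <= K)%N].

Lemma sum_half_le2 (K : nat) : \sum_(k < K) (2^-1 : R) ^+ k <= 2.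
Proof.
suff -> : \sum_(k < K) (2^-1 : R) ^+ k = 2 - 2 * 2^-1 ^+ K.
  by rewrite lerBlDr lerDl mulr_ge0// exprn_ge0.
elim: K => [|K IH]; first by rewrite big_ord0 expr0 mulr1 subrr.
by rewrite big_ord_recr/= IH exprS; field.
Qed.

(** Counting by a generating function: weigh each used coordinate by x = s / p
    and each unit of size by 1 / 2. Then a code of the set has weight at least
    x^s 2^-K, and the total weight of all codes is a p-th power of at most
    1 + 4 x, hence at most exp(4 s). *)
Lemma card_cheap_codes (p s K : nat) : (1 <= s <= p)%N ->
  (#|cheap_codes p s K|%:R : R) <=
    (p%:R / s%:R) ^+ s * 2 ^+ K * expR (4 * s%:R).
Proof.
move=> /andP[s1 sp].
have s0 : 0 < s%:R :> R by rewrite ltr0n.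
have p0 : 0 < p%:R :> R by rewrite ltr0n (leq_trans s1).
pose x : R := s%:R / p%:R.
have x0 : 0 < x by rewrite divr_gt0.
have x1 : x <= 1 by rewrite ler_pdivrMr// mul1r ler_nat.
pose w (c : cell K) : R := x ^+ cell_supp c * 2^-1 ^+ cell_size c.
have w0 c : 0 <= w c by rewrite mulr_ge0 ?exprn_ge0// ltW.
have sum_w : \sum_c w c <= 1 + 4 * x.
  rewrite (bigD1 None)//= {1}/w /= expr0 expr0 mulr1 lerD2l.
  rewrite (reindex_omap Some id) => [|[]//].
  rewrite (eq_bigl xpredT) => [|c]; last by rewrite /= eqxx.
  rewrite (eq_bigr (fun q => w (Some (q.1, q.2)))) => [|[]//].
  rewrite -(pair_bigA _ (fun b k => w (Some (b, k))))/= big_bool/=.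
  have -> b : \sum_k w (Some (b, k)) = x * \sum_(k < K.+1) 2^-1 ^+ k.
    by rewrite mulr_sumr; apply: eq_bigr => k _; rewrite /w/= expr1.
  have := ler_wpM2l (ltW x0) (sum_half_le2 K.+1); lra.
have total : \sum_(f : {ffun 'I_p -> cell K}) \prod_i w (f i) <= expR (4 * s%:R).
  rewrite -(bigA_distr_bigA (fun _ : 'I_p => w)) prodr_const card_ord.
  apply: (@le_trans _ _ (expR (4 * x) ^+ p)).
    apply: lerXn2r; rewrite ?nnegrE ?expR_ge0 ?sumr_ge0//.
    by apply: le_trans sum_w _; exact: expR_ge1Dx.
  rewrite -expRM_natl ler_expR /x le_eqVlt; apply/orP; left; apply/eqP.
  by field; rewrite gt_eqF.
have cheap f : f \in cheap_codes p s K ->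
    x ^+ s * 2^-1 ^+ K <= \prod_i w (f i).
  rewrite inE => /andP[fs fK]; rewrite big_split/= !GRing.prodrXr.
  apply: ler_pM; rewrite ?exprn_ge0 ?(ltW x0)//.
    by apply: ler_wiXn2l => //; exact: ltW.
  by apply: ler_wiXn2l => //; lra.
have lower : #|cheap_codes p s K|%:R * (x ^+ s * 2^-1 ^+ K) <= expR (4 * s%:R).
  apply: le_trans total; rewrite -sumr_const mulr_suml.
  rewrite [leRHS](bigID (mem (cheap_codes p s K)))/=.
  rewrite -[leLHS]addr0; apply: lerD; last by apply: sumr_ge0 => f _; exact: prodr_ge0.
  by apply: ler_sum => f fc; rewrite mul1r cheap.
rewrite -ler_pdivrMl ?mulr_gt0 ?exprn_gt0 ?divr_gt0//.
rewrite mulrC; apply: le_trans lower; rewrite ler_wpM2l//.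
rewrite invfM -!exprVn invf_div.
by [].
Qed.

End codes.

Section code_cover.

(** A grid would leave D. One representative in D for each realized code covers
    D up to the size of a cell. *)
Lemma code_cover (U : Type) (F : finType) (code : U -> F) (good : {set F})
    (D : set U) : (forall t, D t -> code t \in good) ->
  exists (N : nat) (th : 'I_N -> U), [/\ (N <= #|good|)%N,
    forall j, D (th j) & forall t, D t -> exists j, code (th j) = code t].
Proof.
move=> Dgood.
pose G : {set F} := finset (fun f => `[< exists t, D t /\ code t = f >]).
have repr (j : 'I_#|G|) : {t | D t /\ code t = enum_val j}.
  by apply: cid; apply/asboolP; have := enum_valP j; rewrite inE.
exists #|G|, (fun j => sval (repr j)); split.
- apply/subset_leq_card/fintype.subsetP => f; rewrite inE => /asboolP[t [Dt <-]].
  exact: Dgood.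
- by move=> j; case: (svalP (repr j)).
- move=> t Dt; have tG : code t \in G by rewrite inE; apply/asboolP; exists t.
  exists (enum_rank_in tG (code t)).
  by have [_ ->] := svalP (repr (enum_rank_in tG (code t))); rewrite enum_rankK_in.
Qed.

End code_cover.

Section sparse_cover.
Context {R : realType} {p : nat}.
Implicit Types t theta : 'cV[R]_p.

Definition offset theta (h : R) t (i : 'I_p) : R := (t i 0 - theta i 0) / h.

Definition sparse_code theta (h : R) (K : nat) t : {ffun 'I_p -> cell K} :=
  [ffun i => if t i 0 == 0 then None else
     Some (0 <= offset theta h t i, inord (Num.trunc `|offset theta h t i|))].

(** Equal signs and equal truncated absolute values confine two reals to one
    interval of length 1, and outside the common support both vanish. *)
Lemma sparse_code_close theta (h : R) (K s : nat) t t' : 0 < h ->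
  (#|supp t| <= s)%N ->
  (forall i, t i 0 != 0 -> (Num.trunc `|offset theta h t i| <= K)%N) ->
  (forall i, t' i 0 != 0 -> (Num.trunc `|offset theta h t' i| <= K)%N) ->
  sparse_code theta h K t = sparse_code theta h K t' ->
  enorm (t - t') ^+ 2 <= s%:R * h ^+ 2.
Proof.
move=> h0 ts tK t'K code_eq; rewrite sqr_enorm.
have coord i : (t - t') i 0 ^+ 2 <= (i \in supp t)%:R * h ^+ 2.
  rewrite inE !mxE; have /ffunP/(_ i) := code_eq; rewrite !ffunE.
  have [->|ti] := eqVneq (t i 0) 0; have [->|t'i] := eqVneq (t' i 0) 0 => //.
    by rewrite subrr expr0n mul0r.
  set u := offset _ _ t i; set u' := offset _ _ t' i.
  move=> -[signs /(congr1 (@nat_of_ord _))].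
  rewrite !inordK ?ltnS ?tK ?t'K// => truncs; rewrite mul1r.
  have /andP[a1 a2] := truncn_itv (normr_ge0 u).
  have /andP[b1 b2] := truncn_itv (normr_ge0 u').
  have uu : `|u - u'| <= 1.
    rewrite -truncs -natr1 in b1 b2; rewrite -natr1 in a2.
    have [u0|u0] := leP 0 u.
      rewrite u0 in signs; have u'0 : 0 <= u' by rewrite -signs.
      rewrite (ger0_norm u0) (ger0_norm u'0) in a1 a2 b1 b2.
      by rewrite ler_norml; apply/andP; split; lra.
    rewrite (lt_geF u0) in signs; have u'0 : u' < 0 by rewrite ltNge -signs.
    rewrite (ltr0_norm u0) (ltr0_norm u'0) in a1 a2 b1 b2.
    by rewrite ler_norml; apply/andP; split; lra.
  have -> : t i 0 - t' i 0 = (u - u') * h.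
    by rewrite /u /u' /offset; field; rewrite gt_eqF.
  rewrite exprMn ler_piMl ?sqr_ge0// -(real_normK (num_real _)).
  by rewrite expr_le1.
apply: le_trans (ler_sum _ (fun i _ => coord i)) _.
rewrite -mulr_suml ler_wpM2r ?sqr_ge0// -natr_sum ler_nat.
by apply: leq_trans ts; rewrite -sum1_card [leqRHS]big_mkcond.
Qed.

Lemma sparse_code_cheap theta (h : R) (s : nat) (B : R) t : 0 < h -> 0 <= B ->
  (#|supp t| <= s)%N ->
  \sum_(i in supp t) `|offset theta h t i| <= B ->
  (forall i, t i 0 != 0 ->
    (Num.trunc `|offset theta h t i| <= Num.trunc B)%N) /\
  sparse_code theta h (Num.trunc B) t \in cheap_codes p s (Num.trunc B).
Proof.
move=> h0 B0 ts tB; set K := Num.trunc B.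
have tK i : t i 0 != 0 -> (Num.trunc `|offset theta h t i| <= K)%N.
  move=> ti; apply: le_truncn; apply: le_trans tB.
  by rewrite (bigD1 i) ?inE//= lerDl sumr_ge0.
split=> //; rewrite inE; apply/andP; split.
  apply: leq_trans ts; rewrite -sum1_card [leqRHS]big_mkcond/=.
  by apply: leq_sum => i _; rewrite ffunE inE; case: eqP.
rewrite /K truncn_ge_nat// natr_sum; apply: le_trans tB.
rewrite [leRHS]big_mkcond/=; apply: ler_sum => i _; rewrite ffunE inE.
case: eqP => //= /eqP ti; rewrite inordK ?ltnS ?tK//.
by have /andP[] := truncn_itv (normr_ge0 (offset theta h t i)).
Qed.

(** With mesh eta / sqrt s, cells have diameter at most eta, and a point of the
    ball has offsets of l^1 norm at most s rho, so that [card_cheap_codes]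
    applies with K of this order. Exponential growth in rho is cruder than the
    rho^s of a volume argument, but it is all that [peeling] requires. *)
Lemma sparse_ball_cover theta (eta rho : R) (s : nat) (D : set 'cV[R]_p) :
  (1 <= s <= p)%N -> 0 < eta -> 0 < rho ->
  (forall t, D t -> (#|supp t| <= s)%N /\ enorm (t - theta) <= rho * eta) ->
  exists (N : nat) (th : 'I_N -> 'cV[R]_p),
    [/\ N%:R <= expR (4 * sparse_entropy R s p + s%:R * rho),
      forall j, D (th j) &
      forall t, D t -> exists j, enorm (th j - t) <= eta].
Proof.
move=> /andP[s1 sp] eta0 rho0 hD.
have s0 : 0 < s%:R :> R by rewrite ltr0n.
have p0 : 0 < p%:R :> R by rewrite ltr0n (leq_trans s1).
pose h := eta / Num.sqrt s%:R.
have h0 : 0 < h by rewrite divr_gt0// sqrtr_gt0.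
have h2 : s%:R * h ^+ 2 = eta ^+ 2.
  by rewrite expr_div_n sqr_sqrtr ?ltW//; field; rewrite gt_eqF.
pose B := s%:R * rho; have B0 : 0 <= B by rewrite mulr_ge0// ltW.
have l1 t : D t -> \sum_(i in supp t) `|offset theta h t i| <= B.
  move=> /hD[ts td].
  (* |x / h| <= ((x / h)^2 / rho + rho) / 2, which is optimal at |x / h| = rho *)
  apply: (@le_trans _ _ (\sum_(i in supp t)
      (((t - theta) i 0 ^+ 2 / (h ^+ 2 * rho) + rho) / 2))).
    apply: ler_sum => i _; rewrite !mxE /offset; set x := t i 0 - theta i 0.
    have -> : x ^+ 2 / (h ^+ 2 * rho) = `|x / h| ^+ 2 / rho.
      by rewrite real_normK ?num_real//; field; rewrite !gt_eqF.
    rewrite -subr_ge0.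
    have -> : (`|x / h| ^+ 2 / rho + rho) / 2 - `|x / h| =
      (`|x / h| - rho) ^+ 2 / (2 * rho) by field; rewrite gt_eqF.
    by rewrite divr_ge0 ?sqr_ge0// mulr_ge0// ltW.
  rewrite -mulr_suml big_split/= sumr_const -mulr_suml.
  have h3 : \sum_(i in supp t) (t - theta) i 0 ^+ 2 <= (rho * eta) ^+ 2.
    apply: (@le_trans _ _ (enorm (t - theta) ^+ 2)).
      rewrite sqr_enorm [leRHS](bigID (mem (supp t)))/= lerDl sumr_ge0// => i _.
      exact: sqr_ge0.
    by rewrite lerXn2r ?nnegrE ?enorm_ge0// mulr_ge0//; exact: ltW.
  have h4 : (\sum_(i in supp t) (t - theta) i 0 ^+ 2) / (h ^+ 2 * rho) <= B.
    have hr : 0 < h ^+ 2 * rho by rewrite mulr_gt0 ?exprn_gt0.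
    rewrite ler_pdivrMr//; apply: le_trans h3 _.
    rewrite exprMn -h2 /B le_eqVlt; apply/orP; left; apply/eqP; ring.
  have h5 : rho *+ #|supp t| <= B.
    by rewrite -mulr_natl /B (ler_wpM2r (ltW rho0))// ler_nat.
  by rewrite ler_pdivrMr//; lra.
have [N [th [Nle thD thcov]]] := code_cover (code := sparse_code theta h (Num.trunc B))
  (good := cheap_codes p s (Num.trunc B)) (D := D)
  (fun t Dt => (sparse_code_cheap h0 B0 (hD t Dt).1 (l1 t Dt)).2).
exists N, th; split=> //; last first.
  move=> t Dt; have [j hj] := thcov t Dt; exists j.
  rewrite -(ler_pXn2r (n := 2)) ?nnegrE ?enorm_ge0 ?(ltW eta0)// -h2.
  apply: (sparse_code_close h0 (hD _ (thD j)).1 _ _ hj).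
    exact: (sparse_code_cheap h0 B0 (hD _ (thD j)).1 (l1 _ (thD j))).1.
  exact: (sparse_code_cheap h0 B0 (hD t Dt).1 (l1 t Dt)).1.
apply: (@le_trans _ _ (#|cheap_codes p s (Num.trunc B)|%:R)); first by rewrite ler_nat.
apply: le_trans (card_cheap_codes (Num.trunc B) _) _; first by rewrite s1.
rewrite expRD mulrAC; apply: ler_pM => //.
- have ps : 0 < p%:R / s%:R :> R by rewrite divr_gt0.
  have -> : (p%:R / s%:R : R) ^+ s = expR (s%:R * ln (p%:R / s%:R)).
    by rewrite expRM_natl lnK ?posrE.
  rewrite -expRD ler_expR /sparse_entropy -mulrA lnM ?posrE ?expR_gt0// expRK.
  have : 0 <= s%:R * ln (p%:R / s%:R) :> R.
    rewrite mulr_ge0// ln_ge0//.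
    by rewrite ler_pdivlMr// mul1r ler_nat.
  lra.
- apply: (@le_trans _ _ (expR (Num.trunc B)%:R)).
    rewrite -[X in expR X]mulr1 expRM_natl lerXn2r ?nnegrE ?expR_ge0//.
    by have := expR_ge1Dx (1 : R); lra.
  by rewrite ler_expR truncn_le.
Qed.

End sparse_cover.

(** * Deviations of empirical frequencies *)

Section union_bound.
Context {R : realType} {d : measure_display} {T : measurableType d}.

Lemma union_bound (Pr : probability T R) (I : finType) (D : pred I)
    (F : I -> set T) (V : set T) : measurable V ->
  (forall i, measurable (F i)) ->
  (forall w, V w -> exists i, D i /\ F i w) ->
  (Pr V <= \sum_(i | D i) Pr (F i))%E.
Proof.
move=> mV mF VF.
have : (Pr (\big[setU/set0]_(i | D i) F i) <= \sum_(i | D i) Pr (F i))%E /\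
    measurable (\big[setU/set0]_(i | D i) F i).
  elim/big_rec2 : _ => [|i e U Di [IH mU]]; first by rewrite measure0.
  split; last exact: measurableU.
  apply: (le_trans (measureU2 _ _ _)) => //.
  by rewrite leeD2l.
move=> [UE mU]; apply: le_trans UE.
apply: le_measure; rewrite ?inE// => w /VF[i [Di Fi]].
by rewrite (bigD1 i)//=; left.
Qed.

End union_bound.

Section binomial_tail.
Context {R : realType}.

Lemma expR_le_quadratic (l : R) : 0 <= l <= 2^-1 ->
  expR l <= 1 + l + 2 * l ^+ 2.
Proof.
move=> /andP[l0 l1]; have h : 0 < 1 - l by lra.
have e1 : expR l * (1 - l) <= 1.
  rewrite -[leRHS](expRxMexpNx_1 l) ler_wpM2l ?expR_ge0//.
  by have := expR_ge1Dx (- l).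
have e2 : expR l <= (1 - l)^-1 by rewrite -ler_pdivlMr// mul1r in e1.
apply: le_trans e2 _; rewrite -div1r ler_pdivrMr//.
have : 0 <= l ^+ 2 * (1 - 2 * l) by rewrite mulr_ge0 ?sqr_ge0//; lra.
lra.
Qed.

(** Chernoff's bound for n independent coin flips, at parameter x / 4: it is at
    most 1 / 2, the range of [expR_le_quadratic]. *)
Lemma coin_tail (n : nat) (q x : R) : 0 <= q <= 1 -> 0 <= x <= 2 ->
  \sum_(b : {ffun 'I_n -> bool} | n%:R * (q + x) <= \sum_i (b i)%:R)
     \prod_i (if b i then q else 1 - q) <= expR (- (n%:R * x ^+ 2 / 8)).
Proof.
move=> /andP[q0 q1] /andP[x0 x2]; pose l := x / 4.
have l0 : 0 <= l by rewrite /l; lra.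
have l1 : l <= 2^-1 by rewrite /l; lra.
have pb0 (b : {ffun 'I_n -> bool}) i : 0 <= (if b i then q else 1 - q).
  by case: (b i) => //; lra.
apply: (@le_trans _ _ (\sum_(b : {ffun 'I_n -> bool})
    expR (- (n%:R * (l * (q + x)))) *
    \prod_i (if b i then q * expR l else 1 - q))).
  rewrite [leRHS](bigID (fun b : {ffun 'I_n -> bool} =>
    n%:R * (q + x) <= \sum_i (b i)%:R))/=.
  rewrite -[leLHS]addr0; apply: lerD; last first.
    apply: sumr_ge0 => b _; rewrite mulr_ge0 ?expR_ge0//.
    apply: prodr_ge0 => i _; case: (b i); last by lra.
    by rewrite mulr_ge0 ?expR_ge0.
  apply: ler_sum => b hb.
  have -> : \prod_i (if b i then q * expR l else 1 - q) =
      expR (l * \sum_i (b i)%:R) * \prod_i (if b i then q else 1 - q).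
    rewrite mulr_sumr expR_sum -big_split/=; apply: eq_bigr => i _.
    by case: (b i); rewrite ?mulr1 ?mulr0 ?expR0 ?mul1r// mulrC.
  rewrite mulrA -expRD -[leLHS]mul1r ler_wpM2r ?prodr_ge0//.
  rewrite -[leLHS]expR0 ler_expR.
  by rewrite mulrCA addrC subr_ge0 ler_wpM2l.
rewrite -mulr_sumr -(bigA_distr_bigA (fun (_ : 'I_n) (c : bool) =>
  if c then q * expR l else 1 - q)).
rewrite prodr_const card_ord big_bool/=.
have step : q * expR l + (1 - q) <= expR (l * q + 2 * l ^+ 2).
  apply: le_trans (expR_ge1Dx _).
  have := ler_wpM2l q0 (@expR_le_quadratic l _).
  rewrite l0 l1 => /(_ isT).
  have : q * (2 * l ^+ 2) <= 2 * l ^+ 2.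
    by rewrite ler_piMl// mulr_ge0// sqr_ge0.
  lra.
apply: (@le_trans _ _ (expR (- (n%:R * (l * (q + x)))) *
    expR (l * q + 2 * l ^+ 2) ^+ n)).
  rewrite ler_wpM2l ?expR_ge0// lerXn2r ?nnegrE ?expR_ge0//.
  by rewrite addr_ge0 ?mulr_ge0 ?expR_ge0//; lra.
rewrite -expRM_natl -expRD ler_expR /l le_eqVlt; apply/orP; left; apply/eqP.
by field.
Qed.

End binomial_tail.

Section iid.
Context {R : realType} {d : measure_display} {T : measurableType d}.
Context {n : nat} {d' : measure_display} {Omega : measurableType d'}.
Variables (Pr : probability Omega R) (Z : 'I_n -> Omega -> T).
Variable P : set T -> \bar R.
Hypotheses (hZ : iid_sample Pr Z P) (Pl : additive_law P).

Let count (A : set T) w : R := \sum_(i < n) \1_A (Z i w).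

Lemma measurable_count A : measurable A -> measurable_fun setT (count A).
Proof.
move=> mA; apply: measurable_sum => i.
apply: measurableT_comp; last exact: (hZ.1 i).
exact: measurable_indic.
Qed.

(** The sample gives its probability to each pattern of hits and misses of A,
    so the tail is the finite sum bounded in [coin_tail]. *)
Lemma count_tail A (x : R) : measurable A -> 0 <= x <= 2 ->
  (Pr [set w | n%:R * (fine (P A) + x) <= count A w]%R
    <= (expR (- (n%:R * x ^+ 2 / 8)))%:E)%E.
Proof.
move=> mA hx; set q := fine (P A).
pose W (b : {ffun 'I_n -> bool}) (i : 'I_n) : set T := if b i then A else ~` A.
have mW b i : measurable (W b i).
  by rewrite /W; case: (b i) => //; exact: measurableC.
have mev b : measurable [set w | forall i, W b i (Z i w)].
  rewrite (_ : [set w | _] = \bigcap_(i in [set: 'I_n]) (Z i @^-1` W b i)).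
    apply: fin_bigcap_measurable => // i _.
    by rewrite -[X in measurable X]setTI; exact: (hZ.1 i).
  by apply/seteqP; split=> w /= h i; [move=> _; exact: h i|exact: h i I].
apply: le_trans (union_bound Pr
  (D := fun b : {ffun 'I_n -> bool} => n%:R * (q + x) <= \sum_i (b i)%:R)
  (F := fun b => [set w | forall i, W b i (Z i w)]) _ mev _) _.
- rewrite (_ : [set w | _] = count A @^-1` `[n%:R * (q + x), +oo[%classic).
    rewrite -[X in measurable X]setTI; apply: measurable_count => //.
  by apply/seteqP; split => w; rewrite /= in_itv/= andbT.
- move=> w hw; exists [ffun i => Z i w \in A]; split.
    move: hw; rewrite /count; congr (_ <= _); apply: eq_bigr => i _.
    by rewrite ffunE indicE.
  by move=> i; rewrite /W ffunE; case: ifPn => [/set_mem|/negP h /mem_set].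
rewrite (eq_bigr (fun b : {ffun 'I_n -> bool} =>
    (\prod_i (if b i then q else 1 - q))%:E)) => [|b _]; last first.
  rewrite (hZ.2 (W b) (mW b)) -prodEFin; apply: eq_bigr => i _.
  rewrite -(additive_law_fine Pl (mW b i)) /W; case: (b i) => //.
  by rewrite additive_lawC.
rewrite sumEFin lee_fin; apply: coin_tail => //; exact: additive_law_01.
Qed.

(** A low frequency of A is a high frequency of its complement. *)
Lemma empirical_tail A (x : R) : measurable A -> 0 < x <= 2 -> (0 < n)%N ->
  let V := [set w | x < `|empirical (fun i => Z i w) A - fine (P A)|] in
  measurable V /\ (Pr V <= (2 * expR (- (n%:R * x ^+ 2 / 8)))%:E)%E.
Proof.
move=> mA /andP[x0 x2] n0 V.
have n0' : 0 < n%:R :> R by rewrite ltr0n.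
have mV : measurable V.
  apply: measurable_lt_set => //; apply: measurableT_comp => //.
  apply: measurable_funB => //; apply: measurable_funM => //.
  exact: measurable_count.
split=> //.
pose F (b : bool) := if b then [set w | n%:R * (fine (P A) + x) <= count A w]
  else [set w | n%:R * (fine (P (~` A)) + x) <= count (~` A) w].
have mF b : measurable (F b).
  have mup B y : measurable B -> measurable [set w | y <= count B w].
    move=> mB; rewrite (_ : [set w | _] = count B @^-1` `[y, +oo[%classic).
      by rewrite -[X in measurable X]setTI; apply: measurable_count.
    by apply/seteqP; split => w; rewrite /= in_itv/= andbT.
  by case: b; apply: mup => //; exact: measurableC.
apply: le_trans (union_bound Pr (D := xpredT) mV mF _) _.
  move=> w; rewrite /V /= -/(count A w) ltr_normr => /orP[h|h].
    exists true; split=> //=.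
    by move: h; rewrite /empirical ltrBrDl ltr_pdivlMr// mulrC => /ltW.
  exists false; split=> //=.
  have -> : count (~` A) w = n%:R - count A w.
    have -> : n%:R = \sum_(i < n) (1 : R) by rewrite sumr_const card_ord.
    rewrite /count -sumrB.
    apply: eq_bigr => i _; rewrite !indicE in_setC.
    by case: (_ \in _); rewrite ?subrr ?subr0.
  rewrite additive_lawC//.
  move: h; rewrite /empirical -/(count A w).
  move: (fine (P A)) (count A w) => q c h.
  have : c / n%:R < q - x by lra.
  rewrite ltr_pdivrMr//; lra.
have x02 : 0 <= x <= 2 by rewrite (ltW x0).
rewrite big_bool/= mulr2n mulrDl mul1r EFinD; apply: leeD.
  exact: count_tail.
by apply: count_tail => //; exact: measurableC.
Qed.

End iid.

(** * Peeling *)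

Section peeling.
Context {R : realType}.

Lemma geometric_tail (y : R) (N : nat) : 1 <= y ->
  \sum_(l < N) expR (- (4 * y * l.+1%:R)) <= expR (- y) / 4.
Proof.
move=> y1; pose x := expR (- (4 * y)).
have e2 : 2 <= expR (1 : R) by have := expR_ge1Dx (1 : R); lra.
have x0 : 0 < x by exact: expR_gt0.
have inv_le (k : nat) (z : R) : k%:R <= z -> expR (- z) <= 2^-1 ^+ k.
  move=> kz; rewrite expRN exprVn lef_pV2 ?posrE ?expR_gt0 ?exprn_gt0//.
  apply: (@le_trans _ _ (expR 1 ^+ k)); first by rewrite lerXn2r ?nnegrE ?expR_ge0.
  by rewrite -expRM_natl mulr1 ler_expR.
have x2 : x <= 2^-1 by have := @inv_le 1 (4 * y); rewrite expr1; apply; lra.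
have geo : \sum_(l < N) x ^+ l.+1 <= 2 * x.
  apply: (@le_trans _ _ (2 * x * (1 - x ^+ N))).
    elim: N => [|N IH]; first by rewrite big_ord0 expr0 subrr mulr0.
    rewrite big_ord_recr/=; apply: le_trans (lerD IH (lexx _)) _.
    rewrite exprS; have : 0 <= x * x ^+ N * (1 - 2 * x).
      rewrite mulr_ge0//; last lra.
      by rewrite mulr_ge0 ?exprn_ge0// ltW.
    lra.
  by rewrite ler_piMr ?mulr_ge0 ?(ltW x0)// gerBl exprn_ge0// ltW.
rewrite (eq_bigr (fun l : 'I_N => x ^+ l.+1)) => [|l _]; last first.
  by rewrite /x -expRM_natl; congr expR; ring.
apply: le_trans geo _.
have -> : x = expR (- y) * expR (- (3 * y)) by rewrite -expRD; congr expR; ring.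
have := @inv_le 3 (3 * y).
have -> : 2^-1 ^+ 3 = 8^-1 :> R by rewrite !exprS expr0; field.
move=> h; have {}h := h _; rewrite mulrCA ler_wpM2l ?expR_ge0//.
have : expR (- (3 * y)) <= 8^-1 by apply: h; lra.
lra.
Qed.

(** In units of K r, f is the distance to the true law and the sum is over pairs
    of a far and a near candidate. The shell f in [l, l + 1] contributes at most
    two ball counts times its Gaussian factor: its exponent is y times
    D (2 + 2 K + K a) - (K a)² / c with a = l, which is at most - 4 a once K is
    large compared with c D. The shells form a geometric series. *)
Lemma peeling (I : finType) (f : I -> R) (y D K c : R) :
  1 <= y -> 0 <= D -> 1 <= c -> c * (5 * D + 4) <= K ->
  (forall l : nat, (0 < l)%N ->
    #|finset (fun i => f i <= l%:R)|%:R <= expR (D * y * (1 + K * l%:R))) ->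
  \sum_(i | 1 < f i) \sum_(k | f k <= 1)
     4 * expR (- (y * (K * f i) ^+ 2 / c)) <= expR (- y).
Proof.
move=> y1 D0 c1 DK hcount.
have c0 : 0 < c by lra.
have K4 : 4 <= K.
  by apply: le_trans DK; rewrite -[leLHS]mul1r ler_pM//; lra.
have K0 : 0 < K by lra.
pose near : R := #|finset (fun i => f i <= 1)|%:R.
have nearE x : \sum_(k | f k <= 1) x = near * x.
  rewrite /near -sum1_card natr_sum mulr_suml; apply: eq_big => k; rewrite ?inE//.
  by rewrite mul1r.
under eq_bigr do rewrite nearE.
pose g (l : nat) : R := expR (- (y * (K * l.+1%:R) ^+ 2 / c)).
have [N hN] : exists N : nat, forall i, f i < N.+1%:R.
  exists (\max_i Num.trunc (f i))%N => i; apply: lt_le_trans (truncnS_gt _) _.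
  by rewrite ler_nat ltnS (bigD1 i)//= leq_maxl.
have one i : 1 < f i -> expR (- (y * (K * f i) ^+ 2 / c)) <=
    \sum_(l < N) (f i <= l.+2%:R)%R%:R * g l.
  move=> fi; pose l := (Num.trunc (f i)).-1.
  have t1 : (0 < Num.trunc (f i))%N by rewrite truncn_gt0 ltW.
  have f0 : 0 <= f i by lra.
  have lE : l.+1 = Num.trunc (f i) by rewrite prednK.
  have lN : (l < N)%N by rewrite lE -ltnS truncn_lt_nat.
  rewrite (bigD1 (Ordinal lN))//= -[leLHS]addr0; apply: lerD; last first.
    by apply: sumr_ge0 => k _; rewrite mulr_ge0// expR_ge0.
  have /andP[fl fu] := truncn_itv f0.
  rewrite -lE in fl fu; rewrite (ltW fu) mul1r ler_expR lerN2.
  apply: ler_wpM2r; first by rewrite invr_ge0 ltW.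
  apply: ler_wpM2l; first by lra.
  apply: lerXn2r; rewrite ?nnegrE ?mulr_ge0 ?(ltW K0)//.
  by rewrite ler_wpM2l ?(ltW K0).
have near0 : 0 <= near by rewrite ler0n.
apply: (@le_trans _ _ (\sum_i \sum_(l < N)
    near * 4 * ((f i <= l.+2%:R)%R%:R * g l))).
  rewrite [leRHS](bigID (fun i => 1 < f i))/= -[leLHS]addr0; apply: lerD.
    apply: ler_sum => i fi; rewrite -mulr_sumr mulrA ler_wpM2l ?one//.
    by rewrite mulr_ge0.
  apply: sumr_ge0 => i _; apply: sumr_ge0 => l _.
  by rewrite !mulr_ge0 ?expR_ge0.
rewrite exchange_big/=.
apply: (@le_trans _ _ (\sum_(l < N) 4 * expR (- (4 * y * l.+1%:R)))); last first.
  by rewrite -mulr_sumr; have := geometric_tail N y1; lra.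
apply: ler_sum => l _.
rewrite -mulr_sumr -mulr_suml.
have -> : \sum_i (f i <= l.+2%:R)%R%:R = #|finset (fun i => f i <= l.+2%:R)|%:R :> R.
  rewrite -sum1_card natr_sum [RHS]big_mkcond/=; apply: eq_bigr => i _.
  by rewrite inE; case: (_ <= _).
rewrite -mulrA mulrCA ler_wpM2l//.
apply: (@le_trans _ _ (expR (D * y * (1 + K * 1%:R)) *
    (expR (D * y * (1 + K * l.+2%:R)) * g l))).
  rewrite ler_pM// ?mulr_ge0 ?expR_ge0//; first exact: (hcount 1%N).
  by rewrite ler_wpM2r ?expR_ge0// hcount.
rewrite /g -!expRD ler_expR.
set a := l.+1%:R; have -> : l.+2%:R = a + 1 :> R by rewrite -natr1.
have a1 : 1 <= a by rewrite /a ler1n.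
have K1 : 1 <= K by lra.
have y0 : 0 <= y by lra.
have Ka : 1 <= K * a by rewrite -[1]mulr1 ler_pM.
have step1 : D * (2 + 2 * K + K * a) <= D * (5 * (K * a)).
  rewrite ler_wpM2l//; have : 0 <= K * (a - 1) by rewrite mulr_ge0; lra.
  lra.
have step2 : (5 * D + 4) * (K * a) <= (K * a) ^+ 2 / c.
  rewrite ler_pdivlMr// expr2 mulrAC ler_wpM2r//; first lra.
  rewrite mulrC; apply: le_trans DK _; rewrite ler_peMr//; lra.
have step3 : 4 * a <= 4 * (K * a) by rewrite ler_pM2l// ler_peMl//; lra.
have := ler_wpM2l y0 step1; have := ler_wpM2l y0 step2.
have := ler_wpM2l y0 step3; lra.
Qed.

End peeling.

(** * Minimal covers and tournaments *)

Section local_minimality.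
Context {R : realType} {d : measure_display} {T : measurableType d}.
Context {U : Type} (P : U -> set T -> \bar R) (Theta : set U).
Hypothesis Pl : forall t, Theta t -> additive_law (P t).

(** In a cover of least cardinality the points of a ball cannot outnumber a
    cover of the ball enlarged by delta, which could replace them: whatever
    they cover lies in the enlarged ball. *)
Lemma local_cover_card (delta rho : R) (m N : nat) (th : 'I_m -> U)
    (th' : 'I_N -> U) (t0 : U) :
  minimal_tv_cover P Theta delta th -> Theta t0 ->
  (forall j, Theta (th' j)) ->
  (forall t, Theta t -> tv (P t) (P t0) <= rho + delta ->
     exists j, tv (P (th' j)) (P t) <= delta) ->
  (#|finset (fun j => tv (P (th j)) (P t0) <= rho)%R| <= N)%N.
Proof.
move=> [[thT cov] minm] T0 th'T cov'.
set A := finset _.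
pose th2 (i : 'I_(#|~: A| + N)) :=
  match fintype.split i with
  | inl k => th (enum_val k)
  | inr k => th' k
  end.
have : (m <= #|~: A| + N)%N.
  apply: (minm _ th2); split.
    by move=> i; rewrite /th2; case: fintype.split.
  move=> t Tt; have [j hj] := cov t Tt.
  rewrite (tvE (Pl (thT j)) (Pl Tt)) lee_fin in hj.
  have [jA|jA] := boolP (j \in A).
    have [|k hk] := cov' t Tt.
      apply: le_trans (tv_triangle (Pl Tt) (Pl (thT j)) (Pl T0)) _.
      rewrite (tvC (Pl Tt) (Pl (thT j))) addrC lerD//.
      by move: jA; rewrite inE.
    exists (rshift _ k); rewrite /th2 (unsplitK (inr k)).
    by rewrite (tvE (Pl (th'T k)) (Pl Tt)) lee_fin.
  have jC : j \in ~: A by rewrite inE.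
  exists (lshift _ (enum_rank_in jC j)); rewrite /th2 (unsplitK (inl _)).
  by rewrite enum_rankK_in// (tvE (Pl (thT j)) (Pl Tt)) lee_fin.
have cardA : (#|A| + #|~: A| = m)%N by rewrite cardsC card_ord.
by rewrite -{1}cardA addnC leq_add2l.
Qed.

End local_minimality.

Section duel.
Context {R : realType} {d : measure_display} {T : measurableType d}.
Context {U : Type} (P : U -> set T -> \bar R) (dens : U -> T -> R).
Context {n : nat} (z : 'I_n -> T).
Variables (nu : {measure set T -> \bar R}).
Variables (t u : U).
Hypotheses (Pt : additive_law (P t)) (Pu : additive_law (P u)).
Hypotheses (dt : is_density nu (dens t) (P t)) (du : is_density nu (dens u) (P u)).
Variable y : R.
Hypothesis y_small : 2 * y < tv (P t) (P u).

(** On the Scheffé set the two laws are separated by their total variation, so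
    the frequency cannot be near the probability under both. *)
Lemma duel_won :
  (let A := scheffe_set dens t u in `|empirical z A - fine (P u A)| <= y) ->
  phi P dens z t u.
Proof.
rewrite /phi; have [_ ] := tv_density dt du Pt Pu.
rewrite -/(scheffe_set dens t u).
move: y_small; move: (tv _ _) (empirical z _) (fine (P t _)) (fine (P u _)).
move=> D e a b yD hD /ler_normlP[h1 h2].
apply: (@le_lt_trans _ _ y); first by apply/ler_normlP.
by rewrite ltr_normr; apply/orP; right; lra.
Qed.

Lemma duel_not_lost :
  (let A := scheffe_set dens u t in `|empirical z A - fine (P u A)| <= y) ->
  ~~ phi P dens z u t.
Proof.
rewrite /phi -leNgt; have [_ ] := tv_density du dt Pu Pt.
rewrite -/(scheffe_set dens u t).
move: y_small; rewrite (tvC Pt Pu).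
move: (tv _ _) (empirical z _) (fine (P t _)) (fine (P u _)).
move=> D e a b yD hD /ler_normlP[h1 h2].
apply: (@le_trans _ _ y); first by apply/ler_normlP.
by apply: ltW; rewrite ltr_normr; apply/orP; left; lra.
Qed.

End duel.

Section tournament.
Context {R : realType} {d : measure_display} {T : measurableType d}.
Context {U : Type} (P : U -> set T -> \bar R) (dens : U -> T -> R).
Variable nu : {measure set T -> \bar R}.
Variables (m : nat) (th : 'I_m -> U) (theta : U).
Hypothesis Pth : forall j, additive_law (P (th j)).
Hypothesis Ptheta : additive_law (P theta).
Hypothesis dth : forall j, is_density nu (dens (th j)) (P (th j)).
Let dist j := tv (P (th j)) (P theta).

(** A candidate beyond rho1 loses to all candidates within rho0, while the
    candidate j0 next to the true law loses at most to the others within rho0,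
    hence strictly less often. The conditions on rho0 and rho1 make a deviation
    of an eighth of the larger distance harmless in these duels. *)
Lemma tournament_winner (n : nat) (z : 'I_n -> T) (Pmix : set T -> \bar R)
    (eps rho0 rho1 : R) (j0 win : 'I_m) :
  dist j0 <= rho0 -> 2 * (2 * eps + 3 * dist j0) <= rho0 ->
  rho0 <= rho1 -> 2 * (2 * eps + 3 * rho0) <= rho1 ->
  (forall A, measurable A -> `|fine (Pmix A) - fine (P theta A)| <= eps) ->
  (forall j k, rho0 < dist j -> dist k <= rho0 ->
    let dev A := `|empirical z A - fine (Pmix A)| <= dist j / 8 in
    dev (scheffe_set dens (th j) (th k)) /\
    dev (scheffe_set dens (th k) (th j))) ->
  (forall k, losses P dens z th win <= losses P dens z th k)%N ->
  dist win <= rho1.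
Proof.
move=> j0near gap0 rho01 gap1 mixP good winmin.
rewrite leNgt; apply/negP => win_far.
have fin_le j k A : measurable A -> rho0 < dist j ->
    `|empirical z A - fine (Pmix A)| <= dist j / 8 ->
    `|empirical z A - fine (P (th k) A)| <= dist j / 8 + eps + dist k.
  move=> mA jfar h1; have h2 := mixP A mA.
  have := tv_ub (Pth k) Ptheta mA; rewrite -/(dist k) distrC => h3.
  apply: le_trans (ler_distD (fine (P theta A)) _ _) _.
  apply: lerD => //; apply: le_trans (ler_distD (fine (Pmix A)) _ _) _.
  exact: lerD.
have j00 : 0 <= dist j0 by exact: tv_ge0.
have mS j k : measurable (scheffe_set dens (th j) (th k)).
  by have [] := tv_density (dth j) (dth k) (Pth j) (Pth k).
have gap j k : dist j <= tv (P (th j)) (P (th k)) + dist k.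
  exact: tv_triangle.
have near_wins k : dist k <= rho0 -> phi P dens z (th win) (th k).
  move=> knear; have far : rho0 < dist win by apply: le_lt_trans win_far.
  have wide : 2 * (dist win / 8 + eps + dist k) < tv (P (th win)) (P (th k)).
    by have := gap win k; lra.
  apply: (duel_won (Pth _) (Pth _) (dth _) (dth _) wide).
  have [dev _] := good win k far knear.
  exact: fin_le.
have j0_beats k : rho0 < dist k -> ~~ phi P dens z (th j0) (th k).
  move=> far.
  have wide : 2 * (dist k / 8 + eps + dist j0) < tv (P (th k)) (P (th j0)).
    by have := gap k j0; lra.
  apply: (duel_not_lost (Pth _) (Pth _) (dth _) (dth _) wide).
  have [_ dev] := good k j0 far j0near.
  exact: fin_le.
have := winmin j0; apply/negP; rewrite -ltnNge /losses.
apply: (@leq_ltn_trans (\sum_(k < m | (dist k <= rho0)%R && (k != j0)) 1)%N).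
  rewrite big_mkcond [leqRHS]big_mkcond/=; apply: leq_sum => k _.
  have [//|kj0] := eqVneq k j0; rewrite ?andbF//= andbT.
  have [//|kfar] := leP (dist k) rho0; first by case: phi.
  by rewrite (negbTE (j0_beats k kfar)).
apply: (@leq_trans (\sum_(k < m | (dist k <= rho0)%R) 1)%N).
  by rewrite [ltnRHS](bigD1 j0)//= add1n ltnS.
rewrite big_mkcond [leqRHS]big_mkcond/=; apply: leq_sum => k _.
have [knear|//] := leP (dist k) rho0.
rewrite (near_wins k knear); case: eqVneq => // kwin.
move: knear win_far; rewrite kwin => /le_trans /(_ rho01).
by rewrite leNgt => /negbTE ->.
Qed.

End tournament.

Section tournament_rate.
Context {R : realType} {d : measure_display} {T : measurableType d}.
Context {U : Type} (P : U -> set T -> \bar R) (dens : U -> T -> R).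
Variables (nu : {measure set T -> \bar R}) (Theta : set U).
Hypothesis Pl : forall t, Theta t -> additive_law (P t).
Hypothesis Pd : forall t, Theta t -> is_density nu (dens t) (P t).
Variables (m : nat) (th : 'I_m -> U) (theta : U).
Hypothesis thT : forall j, Theta (th j).
Hypothesis theta_in : Theta theta.
Let dist j := tv (P (th j)) (P theta).

(** A union bound over the pairs of a candidate farther than K r from the true
    law and one within K r, summed by [peeling]; outside of these events
    [tournament_winner] applies with eps replaced by its bound r. *)
Theorem tournament_rate (n : nat) (est : ('I_n -> T) -> U) (delta eps r D K : R)
    (Q : probability T R) (d' : measure_display) (Omega : measurableType d')
    (Pr : probability Omega R) (Z : 'I_n -> Omega -> T) :
  (0 < n)%N -> 0 < r -> 1 <= n%:R * r ^+ 2 ->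
  0 <= eps <= 1 -> eps <= r ->
  tv_cover P Theta delta th -> 2 * (2 * r + 3 * delta) <= K * r ->
  delta <= K * r ->
  0 <= D -> 512 * (5 * D + 4) <= K ->
  (forall l : nat, (0 < l)%N ->
    #|finset (fun j => dist j <= K * l%:R * r)|%:R <=
      expR (D * (n%:R * r ^+ 2) * (1 + K * l%:R))) ->
  tournament_estimator P dens th est ->
  iid_sample Pr Z (mixture eps (P theta) Q) ->
  holds_with_prob Pr
    [set w | exists2 j, est (fun i => Z i w) = th j &
               dist j <= 2 * (2 + 3 * K) * r]
    (1 - expR (- (n%:R * r ^+ 2))).
Proof.
move=> n0 r0 y1 eps01 epsr cov gap0 deltaK D0 DK hcount hest hZ.
have K0 : 0 < K by lra.
have Kr0 : 0 < K * r by rewrite mulr_gt0.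
have Ptheta := Pl theta_in.
have Pth j := Pl (thT j).
have dth j := Pd (thT j).
have Ql := additive_law_probability Q.
set Pmix := mixture eps (P theta) Q.
have Pmixl : additive_law Pmix by exact: additive_law_mixture.
have mS j k : measurable (scheffe_set dens (th j) (th k)).
  by have [] := tv_density (dth j) (dth k) (Pth j) (Pth k).
have dist0 j : 0 <= dist j by exact: tv_ge0.
have dist1 j : dist j <= 1 by exact: tv_le1.
pose S (q : 'I_m * 'I_m * bool) :=
  if q.2 then scheffe_set dens (th q.1.1) (th q.1.2)
  else scheffe_set dens (th q.1.2) (th q.1.1).
pose F (q : 'I_m * 'I_m * bool) : set Omega := [set w | dist q.1.1 / 8 <
  `|empirical (fun i => Z i w) (S q) - fine (Pmix (S q))|].
pose far (q : 'I_m * 'I_m * bool) : bool :=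
  (K * r < dist q.1.1) && (dist q.1.2 <= K * r).
have mSq q : measurable (S q) by rewrite /S; case: ifP.
have tail q : far q -> measurable (F q) /\
    (Pr (F q) <= (2 * expR (- (n%:R * (dist q.1.1 / 8) ^+ 2 / 8)))%:E)%E.
  move=> /andP[qfar _]; apply: (empirical_tail hZ Pmixl (mSq q)) => //.
  by have := dist1 q.1.1; lra.
pose V := \big[setU/set0]_(q | far q) F q.
have mV : measurable V.
  rewrite /V; elim/big_rec : _ => // q W qfar mW.
  by apply: measurableU => //; case: (tail q qfar).
pose F' q := if far q then F q else set0.
have PrV : (Pr V <= (expR (- (n%:R * r ^+ 2)))%:E)%E.
  apply: le_trans (union_bound Pr (D := far) (F := F') mV _ _) _.
  - by move=> q; rewrite /F'; case: ifPn => // /tail[].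
  - move=> w; rewrite /V; elim/big_rec : _ => // q W qfar IH [Fq|/IH//].
    by exists q; split=> //; rewrite /F' qfar.
  apply: (@le_trans _ _ (\sum_(q | far q)
      (2 * expR (- (n%:R * (dist q.1.1 / 8) ^+ 2 / 8)))%:E)%E).
    by apply: lee_sum => q qfar; rewrite /F' qfar; case: (tail q qfar).
  rewrite sumEFin lee_fin.
  pose f j := dist j / (K * r).
  have fl j l : (f j <= l) = (dist j <= K * l * r).
    by rewrite /f ler_pdivrMr// mulrCA mulrA.
  have f1 j : (f j <= 1) = (dist j <= K * r) by rewrite fl mulr1.
  have hpeel : forall l : nat, (0 < l)%N ->
      #|finset (fun j => f j <= l%:R)|%:R <=
      expR (D * (n%:R * r ^+ 2) * (1 + K * l%:R)).
    move=> l l0; apply: le_trans (hcount l l0); rewrite ler_nat.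
    by apply/subset_leq_card/fintype.subsetP => j; rewrite !inE fl.
  have c1 : 1 <= (512 : R) by rewrite ler1n.
  apply: le_trans (peeling y1 D0 c1 DK hpeel).
  rewrite (pair_big (fun j => 1 < f j) (fun k => f k <= 1)
    (fun j _ => 4 * expR (- (n%:R * r ^+ 2 * (K * f j) ^+ 2 / 512))))/=.
  rewrite (eq_bigl (fun q : 'I_m * 'I_m * bool =>
     ((1 < f q.1.1) && (f q.1.2 <= 1)) && true)) => [|q]; last first.
    by rewrite andbT /far ltNge -!f1 -ltNge.
  rewrite -(pair_big (fun p : 'I_m * 'I_m => (1 < f p.1) && (f p.2 <= 1))
    xpredT (fun p (_ : bool) =>
      2 * expR (- (n%:R * (dist p.1 / 8) ^+ 2 / 8))))/=.
  apply: ler_sum => -[j k] /= _; rewrite big_bool/= -mulrDl.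
  have -> : n%:R * (dist j / 8) ^+ 2 / 8 =
      n%:R * r ^+ 2 * (K * f j) ^+ 2 / 512.
    by rewrite /f; field; rewrite ?gt_eqF.
  rewrite ler_wpM2r ?expR_ge0//; lra.
exists (~` V); split; first exact: measurableC.
- move=> w Vw; have [win [estw winmin]] := hest (fun i => Z i w).
  exists win => //.
  have [j0 hj0] := cov.2 theta theta_in.
  rewrite (tvE (Pth j0) Ptheta) lee_fin -/(dist j0) in hj0.
  have VF q w' : far q -> F q w' -> V w' by move=> qf Fq; rewrite /V (bigD1 q)//; left.
  apply: (tournament_winner (dens := dens) Pth Ptheta dth (z := fun i => Z i w)
    (Pmix := Pmix) (eps := r) (rho0 := K * r) (j0 := j0)) => //.
  + exact: le_trans deltaK.
  + rewrite -/(dist j0); apply: le_trans gap0; lra.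
  + have : 0 <= (5 * K + 4) * r by rewrite mulr_ge0//; lra.
    lra.
  + lra.
  + move=> A mA; apply: le_trans epsr.
    have -> : fine (Pmix A) - fine (P theta A) =
        eps * (fine (Q A) - fine (P theta A)).
      rewrite /Pmix /mixture -(additive_law_fine Ptheta mA).
      by rewrite -(additive_law_fine Ql mA) -!EFinM -EFinD/=; ring.
    have /andP[e0 e1] := eps01.
    rewrite normrM (ger0_norm e0) ler_piMr//.
    exact: le_trans (tv_ub Ql Ptheta mA) (tv_le1 Ql Ptheta).
  + move=> j k jfar knear; split; rewrite leNgt; apply/negP => bad; apply: Vw.
      by apply: (VF (j, k, true)); rewrite ?/far/= ?jfar.
    by apply: (VF (j, k, false)); rewrite ?/far/= ?jfar.
- rewrite (probability_setC Pr mV) EFinB leeB//.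
Qed.

End tournament_rate.

(** * Sparse regression *)

Lemma sparse_entropy_ge (R : realType) (s p : nat) : (1 <= s <= p)%N ->
  s%:R <= sparse_entropy R s p.
Proof.
move=> /andP[s1 sp]; have s0 : 0 < s%:R :> R by rewrite ltr0n.
rewrite /sparse_entropy -[leLHS]mulr1 ler_wpM2l// -[leLHS](@expRK R).
rewrite ler_ln ?posrE ?expR_gt0//; last first.
  by rewrite divr_gt0// mulr_gt0 ?expR_gt0// ltr0n (leq_trans s1).
by rewrite ler_pdivlMr// ler_pM2l ?expR_gt0// ler_nat.
Qed.

Section sparse_regression.
Context {R : realType} {p : nat}.
Variables (s : nat) (M b2 sigma kappa kappa_u : R) (Sigma rootS : 'M[R]_p).
Hypotheses (hs : (1 <= s)%N) (hsp : (2 * s <= p)%N).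
Hypotheses (hb2 : 0 < b2) (hsigma : 0 < sigma) (hkappa : 0 < kappa)
  (hkappa_u : 0 < kappa_u) (hkappas : kappa_u <= b2 * kappa).
Hypothesis hroot : is_psd_sqrt Sigma rootS.
Hypothesis hinf : (kappa%:E <= ereal_inf (stretch_ratios rootS (2 * s)))%E.
Hypothesis hsup : (ereal_sup (stretch_ratios rootS (2 * s)) <= kappa_u%:E)%E.
Variable mu : probability (p.-tuple R) R.
Hypothesis hmu : centered_gaussian Sigma mu.

Local Notation Theta := (param_set s M sigma kappa).
Local Notation P theta := (regression_law mu sigma theta).
Local Notation sep := (tv_sep (2 * b2 * M)).

Lemma tv_sep_gt0 (T : R) : 0 < tv_sep T.
Proof. by rewrite mulr_gt0 ?expR_gt0// exprn_gt0// normal_peak_gt0. Qed.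

Lemma param_set_stretch t u : Theta t -> Theta u ->
  kappa * enorm (t - u) <= enorm (rootS *m (t - u)) <= kappa_u * enorm (t - u).
Proof.
move=> [ts _] [us _]; apply: (sparse_stretch hinf hsup); try exact: ltW.
rewrite hsp andbT; apply: leq_trans (card_supp_sub t u) _.
by rewrite mul2n -addnn leq_add.
Qed.

Lemma param_set_tv_le t u : Theta t -> Theta u ->
  tv (P t) (P u) <= b2 * kappa / sigma * enorm (t - u).
Proof.
move=> tT uT; apply: le_trans (regression_tv_le hmu hsigma t u) _.
rewrite (sqrt_quad_form _ hroot) mulrAC ler_pM2r ?invr_gt0//.
have /andP[_ h] := param_set_stretch tT uT; apply: le_trans h _.
by rewrite ler_wpM2r ?enorm_ge0.
Qed.

(** The diameter of the parameter set keeps the ratio below 2 b2 M. *)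
Lemma param_set_tv_ge t u : Theta t -> Theta u ->
  sep * (enorm (rootS *m (t - u)) / sigma) <= tv (P t) (P u).
Proof.
move=> tT uT; rewrite -(sqrt_quad_form _ hroot).
apply: (regression_tv_ge hmu hsigma); rewrite (sqrt_quad_form _ hroot).
have /andP[_ h] := param_set_stretch tT uT; apply: le_trans h _.
have dtu : enorm (t - u) <= 2 * (M * sigma / kappa).
  case: tT uT => _ tM [_ uM]; apply: le_trans (enormD _ _) _.
  by rewrite enormN; lra.
apply: (@le_trans _ _ (b2 * kappa * enorm (t - u))).
  by rewrite ler_wpM2r ?enorm_ge0.
apply: (@le_trans _ _ (b2 * kappa * (2 * (M * sigma / kappa)))).
  by rewrite ler_wpM2l// mulr_ge0 ?ltW.
by rewrite le_eqVlt; apply/orP; left; apply/eqP; field; rewrite gt_eqF.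
Qed.

(** Total variation balls sit inside Euclidean balls by the lower comparison,
    and Euclidean covers are total variation covers by the upper one. The ratio
    of radius to mesh, on which alone [sparse_ball_cover] depends, is free of
    sigma and kappa. *)
Lemma regression_local_count (delta rho : R) (m : nat)
    (th : 'I_m -> 'cV[R]_p) (theta : 'cV[R]_p) :
  0 < delta -> 0 <= rho -> Theta theta ->
  minimal_tv_cover (regression_law mu sigma) Theta delta th ->
  #|finset (fun j => tv (P (th j)) (P theta) <= rho)|%:R <=
    expR (4 * sparse_entropy R s p +
          s%:R * (b2 / sep * (1 + rho / delta))).
Proof.
move=> delta0 rho0 thetaT hth.
have c0 : 0 < sep := tv_sep_gt0 _.
have Pl t : Theta t -> additive_law (P t).
  by move=> _; apply: additive_law_regression; rewrite gt_eqF.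
pose eta := delta * sigma / (b2 * kappa).
have eta0 : 0 < eta by rewrite divr_gt0 ?mulr_gt0.
have rho'0 : 0 < b2 / sep * (1 + rho / delta).
  by rewrite mulr_gt0 ?divr_gt0// ltr_pwDl// divr_ge0// ltW.
pose Dset := [set t | Theta t /\ tv (P t) (P theta) <= rho + delta].
have sp : (1 <= s <= p)%N.
  by rewrite hs (leq_trans _ hsp)// mul2n -addnn leq_addr.
have hD t : Dset t -> (#|supp t| <= s)%N /\
    enorm (t - theta) <= b2 / sep * (1 + rho / delta) * eta.
  move=> [tT ttv]; split; first by case: tT.
  have h1 := param_set_tv_ge tT thetaT.
  have /andP[h2 _] := param_set_stretch tT thetaT.
  have -> : b2 / sep * (1 + rho / delta) * eta =
      (rho + delta) * sigma / (sep * kappa).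
    by rewrite /eta; field; rewrite !gt_eqF.
  rewrite (ler_pdivlMr _ _ (mulr_gt0 c0 hkappa)).
  have -> : enorm (t - theta) * (sep * kappa) = sep * (kappa * enorm (t - theta)).
    by ring.
  apply: (@le_trans _ _ (sep * enorm (rootS *m (t - theta)))).
    by rewrite ler_pM2l.
  rewrite mulrA (ler_pdivrMr _ _ hsigma) in h1.
  by apply: le_trans h1 _; rewrite ler_pM2r.
have [N [th' [Nle th'D cov]]] := sparse_ball_cover sp eta0 rho'0 hD.
apply: le_trans Nle; rewrite ler_nat.
apply: (local_cover_card Pl hth thetaT (th' := th')).
  by move=> j; case: (th'D j).
move=> t tT ttv; have [j hj] := cov t (conj tT ttv); exists j.
apply: le_trans (param_set_tv_le (th'D j).1 tT) _.
apply: (@le_trans _ _ (b2 * kappa / sigma * eta)).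
  by rewrite ler_wpM2l// divr_ge0 ?mulr_ge0 ?ltW.
by rewrite /eta le_eqVlt; apply/orP; left; apply/eqP; field; rewrite !gt_eqF.
Qed.

End sparse_regression.

(* a1, a2 are the constants of delta ≍ sqrt(s log(ep/s) / n); b1, b2 those of
   kappa_u ≍ kappa. *)
Theorem corollary4p2 (R : realType) (M a1 a2 b1 b2 : R)
  (hM : 0 < M) (ha1 : 0 < a1) (ha12 : a1 <= a2)
  (hb1 : 0 < b1) (hb12 : b1 <= b2) :
  exists c C C' : R, [/\ 0 < c, 0 < C & 0 < C'] /\
  forall (n s p : nat) (sigma kappa kappa_u : R) (Sigma rootS : 'M[R]_p)
    (hs : (1 <= s)%N) (hsp : (2 * s <= p)%N)
    (hsigma : 0 < sigma) (hkappa : 0 < kappa) (hkappa_u : 0 < kappa_u)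
    (hkappas : b1 * kappa <= kappa_u <= b2 * kappa)
    (hSigma : psd Sigma) (hroot : is_psd_sqrt Sigma rootS)
    (hinf : (kappa%:E <= ereal_inf (stretch_ratios rootS (2 * s)))%E)
    (hsup : (ereal_sup (stretch_ratios rootS (2 * s)) <= kappa_u%:E)%E)
    (hn : sparse_entropy R s p <= c * n%:R)
    (* the model P_theta, and densities with respect to a common measure *)
    (mu : probability (p.-tuple R) R) (hmu : centered_gaussian Sigma mu)
    (nu : {measure set (p.-tuple R * R) -> \bar R})
    (dens : 'cV[R]_p -> p.-tuple R * R -> R)
    (hdens : forall theta, param_set s M sigma kappa theta ->
      is_density nu (dens theta) (regression_law mu sigma theta))
    (* the tournament estimator at scale delta *)
    (delta : R)
    (hdelta : a1 * Num.sqrt (sparse_entropy R s p / n%:R) <= delta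
              <= a2 * Num.sqrt (sparse_entropy R s p / n%:R))
    (m : nat) (th : 'I_m -> 'cV[R]_p)
    (hth : minimal_tv_cover (regression_law mu sigma)
             (param_set s M sigma kappa) delta th)
    (est : ('I_n -> p.-tuple R * R) -> 'cV[R]_p)
    (hest : tournament_estimator (regression_law mu sigma) dens th est)
    (* the contaminated sample *)
    (eps : R) (heps : 0 <= eps <= 1)
    (theta : 'cV[R]_p) (htheta : param_set s M sigma kappa theta)
    (Q : probability (p.-tuple R * R)%type R)
    (d : measure_display) (Omega : measurableType d)
    (Pr : probability Omega R) (Z : 'I_n -> Omega -> p.-tuple R * R)
    (hZ : iid_sample Pr Z (mixture eps (regression_law mu sigma theta) Q)),
    holds_with_prob Pr
      [set w | let err := est (fun i => Z i w) - theta in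
        let rate := Num.max (sparse_entropy R s p / n%:R) (eps ^+ 2) in
        enorm (rootS *m err) ^+ 2 <= C * sigma ^+ 2 * rate /\
        enorm err ^+ 2 <= C * (sigma ^+ 2 / kappa ^+ 2) * rate]
      (1 - expR (- (C' * (sparse_entropy R s p + n%:R * eps ^+ 2)))).
Proof.
have b20 : 0 < b2 by exact: lt_le_trans hb12.
have a20 : 0 < a2 by exact: lt_le_trans ha12.
pose sep := tv_sep (2 * b2 * M).
have sep0 : 0 < sep := tv_sep_gt0 _.
(* D is the rate of growth of the local counts. K is large enough for [peeling]
   at c = 512 and for the duels of the nearest candidate. The winner
   is within 2 (2 + 3 K) r in total variation, and C is the square of the
   resulting bound on the ratio. *)
pose D := 4 + b2 / sep + b2 / sep / a1.
have D0 : 0 <= D by rewrite /D !addr_ge0 ?divr_ge0 ?ltW.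
pose K := 512 * (5 * D + 4) + 6 * a2 + 4.
have K0 : 0 < K by rewrite /K; lra.
have DK : 512 * (5 * D + 4) <= K by rewrite /K; lra.
have aK : 4 + 6 * a2 <= K by rewrite /K; lra.
clearbody K.
have K1 : 0 < 2 * (2 + 3 * K) / sep by rewrite divr_gt0//; lra.
exists 1, ((2 * (2 + 3 * K) / sep) ^+ 2), 2^-1; split.
  by split=> //; exact: exprn_gt0.
move=> n s p sigma kappa kappa_u Sigma rootS hs hsp hsigma hkappa hkappa_u
  /andP[_ hku] hSigma hroot hinf hsup hn mu hmu nu dens hdens delta
  /andP[hdelta1 hdelta2] m th hth est hest eps heps theta htheta Q d Omega Pr Z hZ.
have sp : (1 <= s <= p)%N.
  by rewrite hs (leq_trans _ hsp)// mul2n -addnn leq_addr.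
set L := sparse_entropy R s p in hn hdelta1 hdelta2 *.
have Ls : s%:R <= L by exact: sparse_entropy_ge.
have s1 : 1 <= s%:R :> R by rewrite ler1n.
have L1 : 1 <= L by lra.
rewrite mul1r in hn.
have n0R : 0 < n%:R :> R by lra.
have n0 : (0 < n)%N by rewrite -(ltr0n R).
pose rate := Num.max (L / n%:R) (eps ^+ 2).
have Ln0 : 0 < L / n%:R by rewrite divr_gt0//; lra.
have rate_L : L / n%:R <= rate by rewrite /rate le_max lexx.
have rate_eps : eps ^+ 2 <= rate by rewrite /rate le_max lexx orbT.
have rate0 : 0 < rate by lra.
pose r := Num.sqrt rate.
have r0 : 0 < r by rewrite sqrtr_gt0.
have r2 : r ^+ 2 = rate by rewrite sqr_sqrtr// ltW.
have rL : Num.sqrt (L / n%:R) <= r by rewrite ler_wsqrtr.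
have epsr : eps <= r.
  have /andP[e0 _] := heps.
  by rewrite -(ger0_norm e0) -sqrtr_sqr ler_wsqrtr.
have y_L : L <= n%:R * r ^+ 2 by rewrite r2 -ler_pdivrMl// mulrC.
have y1 : 1 <= n%:R * r ^+ 2 by lra.
have q0 : 0 < Num.sqrt (L / n%:R) by rewrite sqrtr_gt0.
have delta0 : 0 < delta by apply: lt_le_trans hdelta1; rewrite mulr_gt0.
have delta_r : delta <= a2 * r.
  by apply: le_trans hdelta2 _; rewrite ler_wpM2l// ltW.
have aKr : (4 + 6 * a2) * r <= K * r.
  by apply: ler_wpM2r => //; exact: ltW.
have gap : 2 * (2 * r + 3 * delta) <= K * r by lra.
have deltaK : delta <= K * r by lra.
(* delta is not small compared with the entropy: s r / delta = O(n r^2) *)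
have s_delta : s%:R * r / delta <= n%:R * r ^+ 2 / a1.
  rewrite ler_pdivrMr// mulrAC ler_pdivlMr//.
  have h1 : a1 * L <= n%:R * r * delta.
    have -> : a1 * L = n%:R * Num.sqrt (L / n%:R) * (a1 * Num.sqrt (L / n%:R)).
      have q2 : Num.sqrt (L / n%:R) ^+ 2 = L / n%:R by rewrite sqr_sqrtr// ltW.
      have nL : n%:R * (L / n%:R) = L by rewrite mulrCA divff ?mulr1// gt_eqF.
      by rewrite mulrACA -expr2 q2 -mulrA mulrCA nL.
    have n00 : 0 <= n%:R :> R by exact: ltW.
    have q00 := ltW q0; have a10 := ltW ha1.
    by apply: ler_pM => //; [exact: mulr_ge0|exact: ler_wpM2l].
  have h2 : s%:R * a1 <= n%:R * r * delta.
    by apply: le_trans h1; rewrite mulrC ler_wpM2l// ltW.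
  have := ler_wpM2l (ltW r0) h2; lra.
have Pl t : param_set s M sigma kappa t ->
    additive_law (regression_law mu sigma t).
  by move=> _; apply: additive_law_regression; rewrite gt_eqF.
have count (l : nat) : (0 < l)%N ->
    #|finset (fun j => tv (regression_law mu sigma (th j))
         (regression_law mu sigma theta) <= K * l%:R * r)|%:R <=
      expR (D * (n%:R * r ^+ 2) * (1 + K * l%:R)).
  move=> l0; have Kl0 : 0 <= K * l%:R by rewrite mulr_ge0// ltW.
  have Klr0 : 0 <= K * l%:R * r by rewrite mulr_ge0// ltW.
  have bound := regression_local_count hs hsp b20 hsigma hkappa hkappa_u
    hku hroot hinf hsup hmu delta0 Klr0 htheta hth.
  apply: le_trans bound _.
  rewrite ler_expR -/L -/sep; set y := n%:R * r ^+ 2 in y_L y1 s_delta *.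
  set b := b2 / sep; have b0 : 0 <= b by rewrite divr_ge0 ?ltW.
  have y0 : 0 <= y by lra.
  have h1 : s%:R * (b * (1 + K * l%:R * r / delta)) <=
      b * (y + K * l%:R * (y / a1)).
    have -> : s%:R * (b * (1 + K * l%:R * r / delta)) =
        b * (s%:R + K * l%:R * (s%:R * r / delta)) by ring.
    rewrite ler_wpM2l// lerD ?ler_wpM2l//; lra.
  have h2 : 0 <= 4 * y * (K * l%:R) by apply: mulr_ge0 => //; lra.
  have h3 : 0 <= b * y * (K * l%:R) by exact: mulr_ge0 (mulr_ge0 b0 y0) Kl0.
  have h4 : 0 <= b / a1 * y.
    by apply: mulr_ge0 => //; apply: divr_ge0 => //; exact: ltW.
  rewrite /D -/b; lra.
have [E [mE Esub PrE]] := tournament_rate Pl hdens hth.1.1 htheta n0 r0 y1 heps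
  epsr hth.1 gap deltaK D0 DK count hest hZ.
exists E; split=> //.
  move=> w /Esub[j estw hj] /=; rewrite estw -/rate.
  have hge := param_set_tv_ge hsp b20 hsigma hkappa hkappa_u hku hroot
    hinf hsup hmu (hth.1.1 j) htheta.
  have /andP[hlow _] := param_set_stretch hsp hkappa hkappa_u
    hinf hsup (hth.1.1 j) htheta.
  set v := enorm (rootS *m (th j - theta)) in hge hlow *.
  have v0 : 0 <= v by exact: enorm_ge0.
  have vle : v <= 2 * (2 + 3 * K) / sep * sigma * r.
    have h := le_trans hge hj.
    rewrite mulrA ler_pdivrMr// -/sep in h.
    have -> : 2 * (2 + 3 * K) / sep * sigma * r =
      2 * (2 + 3 * K) * r * sigma / sep by ring.
    by rewrite ler_pdivlMr// mulrC.
  have v2 : v ^+ 2 <= (2 * (2 + 3 * K) / sep) ^+ 2 * sigma ^+ 2 * rate.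
    rewrite -r2 -!exprMn; apply: lerXn2r => //; rewrite nnegrE.
    exact: mulr_ge0 (mulr_ge0 (ltW K1) (ltW hsigma)) (ltW r0).
  split=> //.
  set C := (2 * (2 + 3 * K) / sep) ^+ 2 in v2 *.
  have -> : C * (sigma ^+ 2 / kappa ^+ 2) * rate = C * sigma ^+ 2 * rate / kappa ^+ 2.
    by ring.
  rewrite ler_pdivlMr ?exprn_gt0//; apply: le_trans v2.
  rewrite mulrC -exprMn; apply: lerXn2r => //; rewrite nnegrE.
  exact: mulr_ge0 (ltW hkappa) (enorm_ge0 _).
apply: le_trans PrE; rewrite lee_fin lerD2l lerN2 ler_expR lerN2.
(* L and n eps^2 are both at most n r^2, hence the factor 1/2 *)
have : n%:R * eps ^+ 2 <= n%:R * r ^+ 2 by rewrite r2 ler_wpM2l// ltW.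
lra.
Qed.
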